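(* Let $k\ge2$ and $R>0$. Suppose that for each $d\in\mathbb N$ there is a proper density estimator $\hat P=\hat P(X_1,\dots,X_n)\in\mathcal P_{k,d}$ such that for every $\Gamma\in\mathcal G_{k,d}$ and $X_1,\dots,X_n$ i.i.d. from $P_\Gamma$, $\mathbb E\,H(\hat P,P_\Gamma)\le c_k\sqrt{d/n}$, for some constant $c_k$. Then there is an estimator $\hat\Gamma$ of $\Gamma$ based on $2n$ i.i.d. observations from $P_\Gamma$, and a constant $C>0$ (depending only on $R$), such that for every $\Gamma\in\mathcal G_{k,d}$, $$\mathbb E\,W_1(\hat\Gamma,\Gamma)\le (Ck)^{k/2}\sqrt{c_k}\Big(\frac dn\Big)^{1/4}+Ck^5c_k^{1/(2k-1)}\Big(\frac1n\Big)^{1/(4k-2)}.$$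
   Context: $\mathcal G_{k,d}$: $k$-atomic distributions on $\mathbb R^d$ with atoms of Euclidean norm at most $R$. $\mathcal P_{k,d}=\{P_\Gamma:\Gamma\in\mathcal G_{k,d}\}$ with $P_\Gamma=\Gamma*N(0,I_d)$; ''proper'' means the estimator takes values in $\mathcal P_{k,d}$. $H$ is the Hellinger distance $H(P,Q)=(\int(\sqrt p-\sqrt q)^2)^{1/2}$ and $W_1$ the 1-Wasserstein distance with Euclidean cost. *)

(* Defs.v *)
From HB Require Import structures.
From mathcomp Require Import all_boot all_order all_algebra.
From mathcomp Require Import all_classical all_reals all_analysis.
Set Implicit Arguments. Unset Strict Implicit. Unset Printing Implicit Defensive.
Import Order.TTheory GRing.Theory Num.Theory.
Import numFieldNormedType.Exports.
Local Open Scope classical_set_scope.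
Local Open Scope ring_scope.

Section Defs.
Variable R : realType.

(** Points of R^d are d-tuples of reals (product = Borel sigma-algebra). *)

Definition eucl (d : nat) (x : d.-tuple R) : R :=
  Num.sqrt (\sum_(i < d) (tnth x i) ^+ 2).

Definition tsub (d : nat) (x y : d.-tuple R) : d.-tuple R :=
  [tuple tnth x i - tnth y i | i < d].

(** Iterated Lebesgue integral over R^d (for nonnegative measurable
    integrands it equals the integral w.r.t. d-dim Lebesgue measure, Tonelli). *)
Fixpoint iint (d : nat) : (d.-tuple R -> \bar R) -> \bar R :=
  match d return (d.-tuple R -> \bar R) -> \bar R with
  | 0 => fun f => f [tuple]
  | d'.+1 => fun f =>
      (\int[@lebesgue_measure R]_x iint (fun y : d'.-tuple R => f (cons_tuple x y)))%E
  end.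

Fixpoint sint (d n : nat) : (n.-tuple (d.-tuple R) -> \bar R) -> \bar R :=
  match n return (n.-tuple (d.-tuple R) -> \bar R) -> \bar R with
  | 0 => fun F => F [tuple]
  | n'.+1 => fun F =>
      iint (fun x : d.-tuple R => sint (fun xs : n'.-tuple (d.-tuple R) => F (cons_tuple x xs)))
  end.

Definition phi1 (t : R) : R := expR (- (t ^+ 2) / 2) / Num.sqrt (pi *+ 2).
Definition phid (d : nat) (x : d.-tuple R) : R := \prod_(i < d) phi1 (tnth x i).

(** A mixing distribution with k (weighted) atoms in R^d:
    Gamma = sum_j w_j delta_{a_j}. *)
Record mix (k d : nat) := Mix { mw : 'I_k -> R ; ma : 'I_k -> d.-tuple R }.

(** Gamma is a probability distribution (at most k distinct atoms). *)
Definition is_mixdist (k d : nat) (G : mix k d) : Prop :=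
  (forall j, 0 <= mw G j) /\ \sum_(j < k) mw G j = 1.

Definition in_Gkd (rad : R) (k d : nat) (G : mix k d) : Prop :=
  is_mixdist G /\ forall j, eucl (ma G j) <= rad.

Definition mixpdf (k d : nat) (G : mix k d) (x : d.-tuple R) : R :=
  \sum_(j < k) mw G j * phid (tsub x (ma G j)).

Definition hellinger (k d : nat) (G G' : mix k d) : R :=
  Num.sqrt (fine (iint (fun x : d.-tuple R =>
     ((Num.sqrt (mixpdf G x) - Num.sqrt (mixpdf G' x)) ^+ 2)%:E))).

Definition W1 (k d : nat) (G G' : mix k d) : R :=
  inf [set c : R | exists pi : 'I_k -> 'I_k -> R,
         [/\ forall i j, 0 <= pi i j,
             forall i, \sum_(j < k) pi i j = mw G i,
             forall j, \sum_(i < k) pi i j = mw G' j &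
             c = \sum_(i < k) \sum_(j < k) pi i j * eucl (tsub (ma G i) (ma G' j))]].

Definition expect (k d n : nat) (G : mix k d) (F : n.-tuple (d.-tuple R) -> R) : \bar R :=
  sint (fun xs : n.-tuple (d.-tuple R) =>
          ((F xs) * \prod_(i < n) mixpdf G (tnth xs i))%:E).

Definition measurable_est (k d n : nat) (est : n.-tuple (d.-tuple R) -> mix k d) : Prop :=
  (forall j, measurable_fun setT (fun xs => mw (est xs) j)) /\
  (forall j (i : 'I_d), measurable_fun setT (fun xs => tnth (ma (est xs) j) i)).

End Defs.

(* Main.v *)
Require Import Defs.
From HB Require Import structures.
From mathcomp Require Import all_boot all_order all_algebra.
From mathcomp Require Import all_classical all_reals all_analysis.
From mathcomp Require Import measurable_realfun.
From mathcomp Require Import ring lra.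
Import Order.TTheory GRing.Theory Num.Theory.
Import numFieldNormedType.Exports.
Set Implicit Arguments. Unset Strict Implicit. Unset Printing Implicit Defensive.
Local Open Scope ring_scope.

(** The estimator has two stages.  The density estimator in dimension [d],
    fed with the first half of the sample, yields [k] atoms; the second half is
    projected onto a [k]-dimensional space containing them, where the density
    estimator in dimension [k] is used, and its atoms are lifted back.

    Both halves of the analysis rest on one estimate: the moment generating
    functions of two mixing distributions differ at [u] by at most
    [2 exp(|u|^2 + |u| rad)] times the Hellinger distance of the mixtures
    (test functions [exp <u, x>]; being positive, they only involve integrals
    of nonnegative functions).

    First stage: for an atom [a] of weight [w] and its residual [r] orthogonal
    to the estimated atoms, the estimate at [r/|r|] and [-r/|r|] bounds
    [w |r|^2] by a multiple of the Hellinger distance.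

    Second stage: pick a direction [u] of length at most [k^(-1/2)] such that
    [|<u, a - a'>|] is at least [|a - a'|] up to a factor polynomial in [k],
    for all pairs of atoms.  The points [exp <u, a>] then carry two measures on
    a bounded interval whose first [2k - 1] moments are close.  Interpolating
    step functions bounds the difference of the distribution functions in each
    gap between atoms, hence the cost of the monotone coupling.  The shortness
    of [u] keeps the factor [exp(l^2 |u|^2)], [l < 2k], below [exp(4k)], which is
    harmless after taking the [(2k-1)]-th root.

    The projection is a product of Givens rotations, which makes it measurable
    in the first sample and reduces the rotation invariance of the Gaussian to
    the invariance of Lebesgue measure on the plane under shears. *)

(** * Couplings on the line *)

Section transport.
Variable R : realFieldType.

(* The coupling is the monotone one, built greedily: match as much mass as
   possible between the leftmost atoms that still carry some. *)
Lemma exists_coupling (I J S : finType) (y : I -> R) (y' : J -> R) (t g : S -> R) :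
  (forall s, 0 <= g s) ->
  (forall i j, `|y i - y' j| <=
     \sum_s g s * ((Num.min (y i) (y' j) <= t s) && (t s < Num.max (y i) (y' j)))%:R) ->
  forall (w : I -> R) (w' : J -> R), (forall i, 0 <= w i) -> (forall j, 0 <= w' j) ->
  \sum_i w i = \sum_j w' j ->
  exists pi : I -> J -> R,
    [/\ forall i j, 0 <= pi i j,
        forall i, \sum_j pi i j = w i,
        forall j, \sum_i pi i j = w' j &
        \sum_i \sum_j pi i j * `|y i - y' j| <=
        \sum_s g s * `|\sum_(i | y i <= t s) w i - \sum_(j | y' j <= t s) w' j| ].
Proof.
move=> g0 cov w w'.
(* Induction on the number of atoms, on both sides, that still carry mass. *)
have [N] := ubnP (#|[pred i | w i != 0%R]| + #|[pred j | w' j != 0%R]|)%N.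
elim: N w w' => // N IH w w'; rewrite ltnS => leN w0 w'0 ww'.
have [i1 wi1|wz] := pickP (fun i => w i != 0); last first.
  have {}wz i : w i = 0 by apply/eqP; move: (wz i) => /= /negbFE.
  have w'z j : w' j = 0.
    have : \sum_j w' j = 0 by rewrite -ww' big1.
    by move/eqP; rewrite psumr_eq0// => /allP/(_ j); rewrite mem_index_enum => /(_ isT)/eqP.
  exists (fun _ _ => 0); split => //.
  - by move=> i; rewrite wz big1.
  - by move=> j; rewrite w'z big1.
  - rewrite big1; first by apply: sumr_ge0 => s _; rewrite mulr_ge0.
    by move=> i _; rewrite big1// => j _; rewrite mul0r.
have [j1 w'j1|w'z] := pickP (fun j => w' j != 0); last first.
  have {}w'z j : w' j = 0 by apply/eqP; move: (w'z j) => /= /negbFE.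
  have : \sum_i w i = 0 by rewrite ww' big1.
  move/eqP; rewrite psumr_eq0// => /allP/(_ i1); rewrite mem_index_enum => /(_ isT).
  by rewrite (negbTE wi1).
have [i0 wi0 mini] := @Order.TotalTheory.arg_minP _ R I i1 (fun i => w i != 0) y wi1.
have [j0 w'j0 minj] := @Order.TotalTheory.arg_minP _ R J j1 (fun j => w' j != 0) y' w'j1.
pose m := Num.min (w i0) (w' j0).
have m_w : m <= w i0 by rewrite ge_min lexx.
have m_w' : m <= w' j0 by rewrite ge_min lexx orbT.
have m0 : 0 <= m by rewrite le_min w0 w'0.
pose w1 i := w i - (i == i0)%:R * m; pose w1' j := w' j - (j == j0)%:R * m.
have sum_delta (T : finType) (x : T) (P : pred T) (c : R) :
    \sum_(z | P z) (z == x)%:R * c = (P x)%:R * c.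
  have [Px|nPx] := boolP (P x).
    rewrite (bigD1 x)//= eqxx big1 ?addr0// => z /andP[_ /negbTE ->]; exact: mul0r.
  rewrite big1 ?mul0r// => z Pz; case: eqVneq => [zx|_]; rewrite ?mul0r//.
  by rewrite -zx Pz in nPx.
have w10 i : 0 <= w1 i.
  by rewrite /w1; case: eqVneq => [->|_]; rewrite ?mul1r ?mul0r ?subr0// subr_ge0.
have w1'0 j : 0 <= w1' j.
  by rewrite /w1'; case: eqVneq => [->|_]; rewrite ?mul1r ?mul0r ?subr0// subr_ge0.
have w1sub i : w1 i != 0 -> w i != 0.
  rewrite /w1; have [->|_] := eqVneq i i0; by rewrite ?mul0r ?subr0.
have w1'sub j : w1' j != 0 -> w' j != 0.
  rewrite /w1'; have [->|_] := eqVneq j j0; by rewrite ?mul0r ?subr0.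
have sub1 : [pred i | w1 i != 0%R] \subset [pred i | w i != 0%R].
  by apply/fintype.subsetP => i; rewrite !inE; exact: w1sub.
have sub2 : [pred j | w1' j != 0%R] \subset [pred j | w' j != 0%R].
  by apply/fintype.subsetP => i; rewrite !inE; exact: w1'sub.
(* Moving the smaller of the two leftmost masses exhausts one of the two atoms, so the count
   drops. *)
have lt1 : (#|[pred i | w1 i != 0%R]| + #|[pred j | w1' j != 0%R]| < N)%N.
  apply: leq_trans leN.
  have [le_ww|/ltW le_ww] := leP (w i0) (w' j0).
    have mE : m = w i0 by rewrite /m min_l.
    rewrite -addSn leq_add// ?subset_leq_card//.
    apply: proper_card; apply/properP; split => //.
    by exists i0; rewrite !inE// /w1 eqxx mul1r mE subrr eqxx.
  have mE : m = w' j0 by rewrite /m min_r.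
  rewrite -addnS leq_add// ?subset_leq_card//.
  apply: proper_card; apply/properP; split => //.
  by exists j0; rewrite !inE// /w1' eqxx mul1r mE subrr eqxx.
have sum1 : \sum_i w1 i = \sum_j w1' j.
  by rewrite !sumrB ww' !(sum_delta _ _ xpredT).
have [pi [pi0 pi1 pi2 pi3]] := IH w1 w1' lt1 w10 w1'0 sum1.
exists (fun i j => pi i j + (i == i0)%:R * ((j == j0)%:R * m)); split.
- by move=> i j; rewrite addr_ge0// mulr_ge0// mulr_ge0.
- move=> i; rewrite big_split/= pi1 -mulr_sumr (sum_delta _ _ xpredT) mul1r.
  by rewrite /w1 subrK.
- by move=> j; rewrite big_split/= pi2 (sum_delta _ _ xpredT) mul1r /w1' subrK.
- under eq_bigr do under eq_bigr do rewrite mulrDl.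
  under eq_bigr do rewrite big_split/=.
  rewrite big_split/=.
  have -> : \sum_i \sum_j (i == i0)%:R * ((j == j0)%:R * m) * `|y i - y' j| =
      m * `|y i0 - y' j0|.
    rewrite (bigD1 i0)//= [X in _ + X]big1 ?addr0; last first.
      by move=> i /negbTE ->; rewrite big1// => j _; rewrite !mul0r.
    rewrite (bigD1 j0)//= [X in _ + X]big1 ?addr0 ?eqxx ?mul1r//.
    by move=> j /negbTE ->; rewrite mul0r mulr0 mul0r.
  apply: (le_trans (lerD pi3 (ler_wpM2l m0 (cov i0 j0)))).
  rewrite mulr_sumr -big_split/=; apply: ler_sum => s _.
  rewrite mulrCA -mulrDr ler_wpM2l//.
  rewrite /w1 /w1' !sumrB !sum_delta.
  set F := \sum_(i | _) w i; set F' := \sum_(j | _) w' j.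
  have Fm : y i0 <= t s -> m <= F.
    move=> h; rewrite /F (bigD1 i0)//=; apply: (le_trans m_w).
    by rewrite lerDl sumr_ge0.
  have Fm' : y' j0 <= t s -> m <= F'.
    move=> h; rewrite /F' (bigD1 j0)//=; apply: (le_trans m_w').
    by rewrite lerDl sumr_ge0.
  have F0 : t s < y i0 -> F = 0.
    move=> h; rewrite /F big1// => i yi; apply/eqP/negP => /negP /mini.
    by rewrite leNgt (le_lt_trans yi h).
  have F'0 : t s < y' j0 -> F' = 0.
    move=> h; rewrite /F' big1// => i yi; apply/eqP/negP => /negP /minj.
    by rewrite leNgt (le_lt_trans yi h).
  (* A threshold on the same side of both atoms leaves F - F' unchanged. Between them one of F, F'
     is zero, because [i0] and [j0] are leftmost, so removing [m] lowers |F - F'| by exactly [m];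
     this pays for the transport of [m]. *)
  rewrite ge_min lt_max.
  have [h1|h1] := leP (y i0) (t s); have [h2|h2] := leP (y' j0) (t s) => /=.
  + by rewrite mulr0 addr0 !mul1r (_ : F - m - _ = F - F')//; ring.
  + rewrite F'0// mulr1 mul1r !mul0r !subr0 !ger0_norm ?subrK//; last by rewrite subr_ge0 Fm.
    exact: le_trans (Fm h1).
  + rewrite F0// mulr1 mul1r mul0r !sub0r oppr0 sub0r !normrN !ger0_norm ?subrK//; last first.
      by rewrite subr_ge0 Fm'.
    exact: le_trans (Fm' h2).
  + by rewrite mulr0 addr0 !mul0r !subr0.
Qed.

End transport.

(** * Gaps between atoms and interpolation of step functions *)

Section separation.
Variable R : realFieldType.

(** Take for [g s] the distance from [t s] to the next larger value of [t], and zero at the maximum.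
    Walking from gap to gap telescopes; the last clause is only an inequality because a value
    attained several times contributes its gap several times. *)
Lemma exists_gaps (S : finType) (t : S -> R) :
  exists g : S -> R,
    [/\ forall s, 0 <= g s,
        forall s, exists u, t u = t s + g s,
        forall s s', t s' <= t s \/ t s + g s <= t s' &
        forall s s', t s <= t s' ->
          t s' - t s <= \sum_r g r * ((t s <= t r) && (t r < t s'))%:R].
Proof.
pose g s := if [pick s' | t s < t s'] is Some s1
  then t [arg min_(s' < s1 | t s < t s') t s']%O - t s else 0.
have gP s : (exists u, [/\ t u = t s + g s, t s < t u & forall s', t s < t s' -> t u <= t s'])
    \/ (g s = 0 /\ forall s', t s' <= t s).
  rewrite /g; case: pickP => [s1 s1P|h]; last first.
    by right; split => // s'; rewrite leNgt h.
  left; have [u uP umin] := @Order.TotalTheory.arg_minP _ R S s1 (fun s' => t s < t s') t s1P.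
  by exists u; split=> //; rewrite addrC subrK.
have g0 s : 0 <= g s.
  case: (gP s) => [[u [tu su _]]|[-> _]//].
  by rewrite -(lerD2l (t s)) addr0 -tu ltW.
exists g; split => //.
- move=> s; case: (gP s) => [[u [tu _ _]]|[-> _]]; first by exists u.
  by exists s; rewrite addr0.
- move=> s s'; case: (gP s) => [[u [tu su umin]]|[_ h]]; last by left.
  by have [h|h] := leP (t s') (t s); [left|right; rewrite -tu; exact: umin].
move=> s s'.
have [N] := ubnP #|[pred r | (t s <= t r) && (t r < t s')]|.
elim: N s => // N IH s; rewrite ltnS => leN.
rewrite le_eqVlt => /orP[/eqP ->|ss'].
  by rewrite subrr sumr_ge0// => r _; rewrite mulr_ge0.
case: (gP s) => [[u [tu su umin]]|[_ /(_ s')]]; last by rewrite leNgt ss'.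
have us' := umin _ ss'.
have ltN : (#|[pred r | ((t u <= t r) && (t r < t s'))%R]| < N)%N.
  apply: leq_trans leN; apply: proper_card; apply/properP; split.
    apply/fintype.subsetP => r; rewrite !inE => /andP[ur ->].
    by rewrite (le_trans (ltW su) ur).
  by exists s; rewrite !inE ?lexx ?ss'// leNgt su.
have := IH u ltN us'.
have -> : t s' - t s = (t s' - t u) + g s by rewrite tu; ring.
move=> h; apply: (le_trans (lerD h (lexx _))).
rewrite (bigD1 s)//= [X in _ <= X](bigD1 s)//= lexx ss' mulr1.
rewrite (leNgt (t u) (t s)) su mulr0 add0r [leLHS]addrC. rewrite lerD2l.
apply: ler_sum => r _; rewrite ler_wpM2l// ler_nat.
case: (boolP (_ && _)) => // /andP[ur rs'].
by rewrite (le_trans (ltW su) ur) rs'.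
Qed.

(* Aitken-Neville interpolation of the step function [x <= al], tracked through
   its effect on the functional [\sum_s v s * f (t s)]. *)
Lemma neville_step (S : finType) (v t : S -> R) (n : nat) (al be de B : R) :
  (forall j, (j < n)%N -> `|\sum_s v s * t s ^+ j| <= de) ->
  0 <= B -> al < be -> be - al <= 2 * (1 + B) ->
  forall (l : seq R) , (forall x, x \in l -> `|x| <= B /\ (x <= al \/ be <= x)) ->
  exists P : R -> R, (forall x, x \in l -> P x = (x <= al)%R%:R) /\
    forall j, (j + maxn 1 (size l) <= n)%N ->
      `|\sum_s v s * (t s ^+ j * P (t s))| <= (2 * (1 + B) / (be - al)) ^+ (size l).-1 * de.
Proof.
move=> mom B0 albe gapB; set K := 2 * (1 + B) / (be - al).
have gap0 : 0 < be - al by rewrite subr_gt0.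
have K1 : 1 <= K by rewrite /K ler_pdivlMr// mul1r.
move=> l; have [N] := ubnP (size l); elim: N l => // N IH l; rewrite ltnS => leN lP.
(* With nodes on one side only, a constant interpolates, and [K >= 1] gives the bound. Otherwise one
   node is picked on each side of the gap. *)
have [/hasP[b bl bbe]|/hasPn nob] := boolP (has (fun x => be <= x) l); last first.
  exists (fun=> 1); split => [x xl|j jn].
    have [_ [->//|]] := lP x xl; by rewrite (negbTE (nob _ xl)).
  have jn1 : (j < n)%N by rewrite -addn1 (leq_trans _ jn)// leq_add2l leq_maxl.
  under eq_bigr do rewrite mulr1.
  apply: (le_trans (mom _ jn1)); rewrite ler_peMl ?exprn_ege1//.
  exact: le_trans (mom _ jn1).
have [/hasP[a al' aal]|/hasPn noa] := boolP (has (fun x => x <= al) l); last first.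
  exists (fun=> 0); split => [x xl|j jn].
    by rewrite (negbTE (noa _ xl)).
  have jn1 : (j < n)%N by rewrite -addn1 (leq_trans _ jn)// leq_add2l leq_maxl.
  rewrite big1 ?normr0; last by move=> s _; rewrite !mulr0.
  by rewrite mulr_ge0 ?exprn_ge0 ?(le_trans ler01 K1)// (le_trans _ (mom _ jn1)).
have ab : a < b by exact: le_lt_trans aal (lt_le_trans albe bbe).
pose r := rem b (rem a l).
have bra : b \in rem a l.
  have := bl; rewrite (perm_mem (perm_to_rem al')) inE => /predU1P[ba|//].
  by rewrite ba ltxx in ab.
have lr : perm_eq l [:: a, b & r].
  by rewrite (perm_trans (perm_to_rem al'))// perm_cons perm_to_rem.
have szl : size l = (size r).+2 by rewrite (perm_size lr).
have sub c x : c \in l -> x \in c :: r -> x \in l.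
  move=> cl; rewrite (perm_mem lr) !inE => /predU1P[->|->]; last by rewrite !orbT.
  by move: cl; rewrite (perm_mem lr) !inE.
have szN : (size r < N)%N.
  by move: leN; rewrite szl => /ltnW.
have [|Pb [Pb1 Pb2]] := IH (b :: r) _ (fun x xl => lP x (sub b x bl xl)).
  by move: leN; rewrite szl.
have [|Pa [Pa1 Pa2]] := IH (a :: r) _ (fun x xl => lP x (sub a x al' xl)).
  by move: leN; rewrite szl.
have ba0 : b - a != 0 by rewrite subr_eq0 gt_eqF.
have albF : (b <= al) = false by apply: negbTE; rewrite -ltNge (lt_le_trans albe).
(* Neville's formula joins the interpolants through [b :: r] and [a :: r]. The factors [x - a] and
   [x - b] raise the order of the moments by one, hence a claim for every [j]; since
   [b - a >= be - al], each level costs at most a factor [K]. *)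
exists (fun x => ((x - a) * Pb x - (x - b) * Pa x) / (b - a)); split => [x|j].
  rewrite (perm_mem lr) !inE => /or3P[/eqP->|/eqP->|xr].
  - rewrite subrr mul0r sub0r -mulNr opprB Pa1 ?mem_head// aal mulr1 divff//.
  - by rewrite subrr mul0r subr0 Pb1 ?mem_head// albF mulr0 mul0r.
  - rewrite Pb1 ?inE ?xr ?orbT// Pa1 ?inE ?xr ?orbT//.
    by rewrite -mulrBl (_ : x - a - (x - b) = b - a); [rewrite mulrAC divff// mul1r|ring].
rewrite szl => jn.
have jn1 : (j.+1 + maxn 1 (size (b :: r)) <= n)%N.
  by move: jn; rewrite /= !maxnSS !max0n addSnnS.
have jn0 : (j + maxn 1 (size (b :: r)) <= n)%N.
  by move: jn; rewrite /= !maxnSS !max0n addnS; exact: ltnW.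
have := Pb2 _ jn1; have := Pb2 _ jn0; have := Pa2 _ jn1; have := Pa2 _ jn0.
rewrite /= => A0 A1 B0' B1.
set E := _ ^+ size r * de in A0 A1 B0' B1 *.
rewrite exprS -mulrA -/E.
set a0 := \sum_s _ in A0; set a1 := \sum_s _ in A1.
set b0 := \sum_s _ in B0'; set b1 := \sum_s _ in B1.
have -> : \sum_s v s * (t s ^+ j * (((t s - a) * Pb (t s) - (t s - b) * Pa (t s)) / (b - a))) =
    (b1 - a * b0 - (a1 - b * a0)) / (b - a).
  rewrite /a0 /a1 /b0 /b1 !mulr_sumr -!sumrB mulr_suml; apply: eq_bigr => s _.
  by rewrite !exprS; ring.
have [aB _] := lP a al'; have [bB _] := lP b bl.
have E0 : 0 <= E by exact: le_trans A0.
have h1 : `|b1 - a * b0 - (a1 - b * a0)| <= 2 * (1 + B) * E.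
  have -> : 2 * (1 + B) * E = (E + B * E) + (E + B * E) by ring.
  apply: (le_trans (ler_normB _ _)); apply: lerD; apply: (le_trans (ler_normB _ _)).
    by apply: lerD => //; rewrite normrM ler_pM.
  by apply: lerD => //; rewrite normrM ler_pM.
have gab : be - al <= b - a by rewrite lerB.
rewrite normrM normfV (gtr0_norm (x := b - a)) ?subr_gt0//.
rewrite ler_pdivrMr ?subr_gt0//; apply: (le_trans h1).
rewrite (_ : K * E * (b - a) = 2 * (1 + B) * E * ((b - a) / (be - al))); last by rewrite /K; ring.
apply: ler_peMr; last by rewrite ler_pdivlMr// mul1r.
by rewrite mulr_ge0// mulr_ge0// addr_ge0.
Qed.

End separation.

(** * Comparison of two measures on the line through their moments *)

Section line.
Variable R : realFieldType.

(** Each gap contributes at most [x] to the cost. If its length [g] is at most [x], this holds since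
    the distribution functions differ by at most 1. For a longer gap the interpolating polynomial of
    degree [n - 1] bounds their difference by (2(1+B)/g)^(n-1) de <= (x/g)^(n-1) <= x/g, where the
    last inequality uses [1 < n]. *)
Lemma moments_coupling (I J : finType) (y : I -> R) (y' : J -> R) (w : I -> R) (w' : J -> R)
    (n : nat) (de B x : R) :
  (#|I| + #|J|)%N = n -> (1 < n)%N ->
  (forall i, 0 <= w i) -> (forall j, 0 <= w' j) ->
  \sum_i w i = 1 -> \sum_j w' j = 1 ->
  (forall i, `|y i| <= B) -> (forall j, `|y' j| <= B) ->
  (forall l, (l < n)%N -> `|\sum_i w i * y i ^+ l - \sum_j w' j * y' j ^+ l| <= de) ->
  0 < x -> (2 * (1 + B)) ^+ n.-1 * de <= x ^+ n.-1 ->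
  exists pi : I -> J -> R,
    [/\ forall i j, 0 <= pi i j,
        forall i, \sum_j pi i j = w i,
        forall j, \sum_i pi i j = w' j &
        \sum_i \sum_j pi i j * `|y i - y' j| <= n%:R * x ].
Proof.
move=> cardn n1 w0 w'0 sw sw' yB y'B mom x0 hx.
pose t (s : I + J) := match s with inl i => y i | inr j => y' j end.
pose v (s : I + J) := match s with inl i => w i | inr j => - w' j end.
have sumE (f : R -> R) : \sum_s v s * f (t s) = \sum_i w i * f (y i) - \sum_j w' j * f (y' j).
  rewrite big_sumType/=; congr (_ + _).
  by rewrite -sumrN; apply: eq_bigr => j _; rewrite mulNr.
have [g [g0 gu gap cov]] := exists_gaps t.
have cov' i j : `|y i - y' j| <=
     \sum_s g s * ((Num.min (y i) (y' j) <= t s) && (t s < Num.max (y i) (y' j)))%:R.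
  have [le|/ltW le] := leP (y i) (y' j).
    by rewrite distrC ger0_norm ?subr_ge0//; exact: (cov (inl i) (inr j)).
  by rewrite ger0_norm ?subr_ge0//; exact: (cov (inr j) (inl i)).
have [pi [pi0 pi1 pi2 pi3]] := exists_coupling g0 cov' w0 w'0 (etrans sw (esym sw')).
exists pi; split => //; apply: (le_trans pi3).
have -> : n%:R * x = \sum_(s : I + J) x.
  by rewrite sumr_const card_sum cardn mulr_natl.
have tB s : `|t s| <= B by case: s.
have B0 : 0 <= B.
  have [s0 _|/eq_card0] := pickP (fun _ : I + J => true); first by rewrite (le_trans _ (tB s0)).
  by rewrite cardT -cardE card_sum cardn => n0; rewrite n0 in n1.
have de0 : 0 <= de by exact: le_trans (mom 0%N (ltnW n1)).
apply: ler_sum => s _.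
have D1 : `|\sum_(i | y i <= t s) w i - \sum_(j | y' j <= t s) w' j| <= 1.
  have F1 : \sum_(i | y i <= t s) w i <= 1.
    by rewrite -sw [leRHS](bigID (fun i => y i <= t s))/= lerDl sumr_ge0.
  have F'1 : \sum_(j | y' j <= t s) w' j <= 1.
    by rewrite -sw' [leRHS](bigID (fun j => y' j <= t s))/= lerDl sumr_ge0.
  have F0 : 0 <= \sum_(i | y i <= t s) w i by exact: sumr_ge0.
  have F'0 : 0 <= \sum_(j | y' j <= t s) w' j by exact: sumr_ge0.
  by rewrite ler_norml; lra.
have [gx|xg] := leP (g s) x.
  by apply: (le_trans _ gx); rewrite -[leRHS]mulr1 ler_wpM2l.
have gs0 : 0 < g s by exact: lt_trans xg.
have gapB : (t s + g s) - t s <= 2 * (1 + B).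
  have [u <-] := gu s; rewrite mulrDr mulr1.
  have /ler_normlP[_ h1] := tB u; have /ler_normlP[h2 _] := tB s.
  by rewrite -[leLHS]addr0 addrC lerD//; lra.
have mom' l : (l < n)%N -> `|\sum_s v s * t s ^+ l| <= de.
  by move=> ln; rewrite (sumE (fun z => z ^+ l)) mom.
have tl z : z \in [seq t s | s <- enum {: I + J}] -> `|z| <= B /\ (z <= t s \/ t s + g s <= z).
  by move=> /mapP[u _ ->]; split.
have albe : t s < t s + g s by rewrite ltrDl.
have [P [P1 P2]] := neville_step mom' B0 albe gapB tl.
have szn : size [seq t s | s <- enum {: I + J}] = n by rewrite size_map -cardE card_sum cardn.
have {P2} := P2 0%N; rewrite szn add0n (maxn_idPr (ltnW n1)) leqnn => /(_ isT).
have -> : \sum_s0 v s0 * (t s0 ^+ 0 * P (t s0)) =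
    \sum_(i | y i <= t s) w i - \sum_(j | y' j <= t s) w' j.
  have Pt s0 : P (t s0) = (t s0 <= t s)%R%:R.
    by apply: P1; apply: map_f; rewrite mem_enum.
  under eq_bigr do rewrite expr0 mul1r Pt.
  rewrite (sumE (fun z => (z <= t s)%R%:R)); congr (_ - _).
    rewrite [RHS]big_mkcond; apply: eq_bigr => i _.
    by case: ifP; rewrite ?mulr1 ?mulr0.
  rewrite [RHS]big_mkcond; apply: eq_bigr => i _.
  by case: ifP; rewrite ?mulr1 ?mulr0.
move=> h; rewrite mulrC -ler_pdivlMr//; apply: (le_trans h).
rewrite addrAC subrr add0r expr_div_n mulrAC.
apply: (@le_trans _ _ ((x / g s) ^+ n.-1)).
  by rewrite expr_div_n ler_wpM2r// invr_ge0 exprn_ge0// ltW.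
rewrite -[leRHS]expr1 ler_wiXn2l//.
- by rewrite divr_ge0 ?ltW.
- by rewrite ler_pdivrMr// mul1r ltW.
- by rewrite -ltnS prednK// ltnW.
Qed.

End line.

(** * A direction that separates finitely many vectors from zero *)

Section direction.
Variable R : realFieldType.

(** Counting: [B v] meets every line parallel to the axis [c v] at most once, so it fills at most a
    fraction 1/N of the grid, and fewer than N such sets cannot cover it. *)
Lemma exists_avoiding (V : finType) (d N : nat) (c : V -> 'I_d) (B : V -> pred {ffun 'I_d -> 'I_N}) :
  (forall v f g, B v f -> B v g -> (forall i, i != c v -> f i = g i) -> f (c v) = g (c v)) ->
  (#|V| < N)%N -> exists f, forall v, ~~ B v f.
Proof.
move=> inj VN; set T := #|{: {ffun 'I_d -> 'I_N}}|.
have cardB v : (N * #|B v| <= T)%N.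
  (* Overwriting the coordinate [c v] of points of [B v] by arbitrary values is injective, which
     gives the fraction 1/N. *)
  pose F (p : 'I_N * {ffun 'I_d -> 'I_N}) : {ffun 'I_d -> 'I_N} :=
    [ffun i => if i == c v then p.1 else p.2 i].
  have Finj : {in [predX 'I_N & B v] &, injective F}.
    move=> [a f] [b g]; rewrite !inE/= => Bf Bg /ffunP e.
    have ab : a = b by have := e (c v); rewrite !ffunE eqxx.
    have fg i : i != c v -> f i = g i.
      by move=> /negbTE ic; have := e i; rewrite !ffunE ic.
    congr pair => //; apply/ffunP => i; have [->|] := eqVneq i (c v); last exact: fg.
    exact: (inj v).
  rewrite -[X in (X * _)%N](card_ord N) -cardX -(card_in_image Finj).
  exact: max_card.
have T0 : (0 < T)%N.
  by rewrite /T card_ffun !card_ord expn_gt0 (leq_ltn_trans _ VN).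
have [f fP|nof] := pickP (fun f => [forall v, ~~ B v f]).
  by exists f => v; move/forallP: fP.
exfalso.
have cov : (T <= \sum_v #|B v|)%N.
  rewrite /T -sum1_card; under [X in (_ <= X)%N]eq_bigr do rewrite -sum1_card big_mkcond/=.
  rewrite exchange_big/=; apply: leq_sum => f _.
  have /negbT := nof f; rewrite negb_forall => /existsP[v]; rewrite negbK => Bvf.
  by rewrite (bigD1 v)//= unfold_in/= Bvf.
have : (N * T <= #|V| * T)%N.
  rewrite (leq_trans (leq_mul (leqnn N) cov))// big_distrr/= -sum_nat_const.
  exact: leq_sum.
by rewrite leq_pmul2r// leqNgt VN.
Qed.

(** Search the grid {0, 1/M, ..., 1}^d with M = #|V|. Let [c z] be a largest coordinate of [v z].
    Two bad points for [z] on a line parallel to the axis [c z] have inner products with [v z] less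
    than |v z (c z)|/M apart, whereas distinct grid points on that line are at least that far apart.
    So each [z] spoils at most one point per line, and M + 1 values per axis leave a good point. *)
Lemma exists_direction (V : finType) d (v : V -> 'I_d -> R) :
  exists th : 'I_d -> R, (forall i, 0 <= th i <= 1) /\
    forall z i, `|v z i| <= 2 * #|V|%:R * `|\sum_j th j * v z j|.
Proof.
case: d v => [|d] v; first by exists (fun=> 0); split => [[]|z []].
pose c z := [arg max_(i > ord0) `|v z i|]%O.
have cP z i : `|v z i| <= `|v z (c z)|.
  by rewrite /c; case: Order.TotalTheory.arg_maxP => // j _; apply.
have [V0|V0] := posnP #|V|.
  exists (fun=> 0); split => [i|z]; first by rewrite lexx ler01.
  by have := max_card (pred1 z); rewrite card1 V0.
set M := #|V|.
pose th (f : {ffun 'I_d.+1 -> 'I_M.+1}) i : R := (f i)%:R / M%:R.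
have M0 : 0 < M%:R :> R by rewrite ltr0n.
pose B z f := 2 * M%:R * `|\sum_j th f j * v z j| < `|v z (c z)|.
have inj z f g : B z f -> B z g -> (forall i, i != c z -> f i = g i) -> f (c z) = g (c z).
  rewrite /B => Bf Bg fg.
  have e : (th f (c z) - th g (c z)) * v z (c z) = \sum_j th f j * v z j - \sum_j th g j * v z j.
    rewrite (bigD1 (c z))//= [X in _ = _ - X](bigD1 (c z))//=.
    rewrite (eq_bigr (fun j => th g j * v z j)); last by move=> j jc; rewrite /th fg.
    by ring.
  have vz0 : 0 < `|v z (c z)|.
    by apply: le_lt_trans Bf; rewrite !mulr_ge0// ltW.
  have : M%:R * `|th f (c z) - th g (c z)| < 1.
    rewrite -(ltr_pM2r vz0) mul1r -mulrA -normrM e.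
    have := ler_normB (\sum_j th f j * v z j) (\sum_j th g j * v z j).
    rewrite -(ler_pM2l M0) => /le_lt_trans; apply; nra.
  rewrite /th -mulrBl normrM (ger0_norm (x := M%:R^-1)) ?invr_ge0 ?ltW// mulrCA divff ?gt_eqF//.
  rewrite mulr1 => lt1; apply/val_inj => /=.
  have [/= h|h|//] := ltngtP (f (c z)) (g (c z)).
    move: lt1; rewrite distrC ger0_norm ?subr_ge0 ?ler_nat 1?ltnW// -natrB 1?ltnW//.
    by rewrite ltrn1 ltnS leqn0 subn_eq0 leqNgt h.
  move: lt1; rewrite ger0_norm ?subr_ge0 ?ler_nat 1?ltnW// -natrB 1?ltnW//.
  by rewrite ltrn1 ltnS leqn0 subn_eq0 leqNgt h.
have [f fP] := exists_avoiding inj (leqnn M.+1).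
exists (th f); split => [i|z i].
  rewrite /th divr_ge0 ?ler0n// ler_pdivrMr// mul1r ler_nat -ltnS; exact: ltn_ord.
by rewrite (le_trans (cP z i))// leNgt; exact: fP.
Qed.

End direction.

Local Open Scope classical_set_scope.

(** * Iterated integrals *)

(** The calculus of integrals of nonnegative functions, common to Lebesgue integration, [iint],
    [sint] and expectations over samples: it is stable under iteration, thanks to [tf_meas], and
    under weighting by a density. Monotonicity asks no measurability, so that a loss such as [W1]
    can be bounded directly. *)
Record tonelli_functional {d} {T : measurableType d} {R : realType}
    (I : (T -> \bar R) -> \bar R) : Prop := TonelliFunctional {
  tf_le : forall f g : T -> \bar R, (forall x, 0 <= f x)%E -> (forall x, f x <= g x)%E ->
    (I f <= I g)%E ;
  tf_add : forall f g : T -> \bar R, measurable_fun setT f -> measurable_fun setT g ->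
    (forall x, 0 <= f x)%E -> (forall x, 0 <= g x)%E ->
    I (fun x => f x + g x)%E = (I f + I g)%E ;
  tf_scale : forall (c : R) (f : T -> \bar R), 0 <= c -> measurable_fun setT f ->
    (forall x, 0 <= f x)%E -> I (fun x => c%:E * f x)%E = (c%:E * I f)%E ;
  tf_meas : forall d' (A : measurableType d') (f : A -> T -> \bar R),
    measurable_fun setT (fun p : A * T => f p.1 p.2) ->
    (forall a x, 0 <= f a x)%E -> measurable_fun setT (fun a => I (f a)) }.

Section functional.
Context {d} {T : measurableType d} {R : realType}.
Implicit Types I : (T -> \bar R) -> \bar R.

Lemma tf_0 I : tonelli_functional I -> I (fun=> 0%E) = 0%E.
Proof.
move=> tI; have := tf_scale tI (lexx 0) (measurable_cst 0%E) (fun=> lexx 0%E).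
by rewrite mul0e => E; rewrite -[RHS]E; congr I; apply/funext => x; rewrite mul0e.
Qed.

Lemma tf_ge0 I f : tonelli_functional I -> (forall x, 0 <= f x)%E -> (0 <= I f)%E.
Proof. by move=> tI f0; rewrite -[leLHS](tf_0 tI); apply: (tf_le tI). Qed.

Lemma tf_sum I n (f : 'I_n -> T -> \bar R) : tonelli_functional I ->
  (forall i, measurable_fun setT (f i)) -> (forall i x, 0 <= f i x)%E ->
  I (fun x => \sum_(i < n) f i x)%E = (\sum_(i < n) I (f i))%E.
Proof.
move=> tI; elim: n f => [|n IH] f mf f0.
  by rewrite [RHS]big_ord0 -[RHS](tf_0 tI); congr I; apply/funext => x; rewrite big_ord0.
rewrite big_ord_recl -IH//.
rewrite -(tf_add tI)//; last 2 first.
- exact: emeasurable_sum.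
- by move=> x; apply: sume_ge0.
by congr I; apply/funext => x; rewrite big_ord_recl.
Qed.

End functional.

Lemma measurable_cons_pair {d d'} {A : measurableType d'} {T : measurableType d} n
  (f : A -> T) (g : A -> n.-tuple T) :
  measurable_fun setT f -> measurable_fun setT g ->
  measurable_fun setT (fun a => cons_tuple (f a) (g a)).
Proof. by move=> mf mg; exact: measurable_cons. Qed.

Lemma tonelli_functional_nil {R : realType} {d} {T : measurableType d} :
  tonelli_functional (fun f : 0.-tuple T -> \bar R => f [tuple]).
Proof.
split=> //= d' A f mf f0.
rewrite (_ : (fun a => _) = (fun p : A * 0.-tuple T => f p.1 p.2) \o (fun a => (a, [tuple])))//.
by apply: measurableT_comp => //; exact: pair2_measurable.
Qed.

Lemma tonelli_functional_cons {R : realType} {d} {T : measurableType d}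
    {n} (I : (T -> \bar R) -> \bar R) (J : (n.-tuple T -> \bar R) -> \bar R) :
  tonelli_functional I -> tonelli_functional J ->
  tonelli_functional (fun f : n.+1.-tuple T -> \bar R =>
     I (fun x => J (fun y => f (cons_tuple x y)))).
Proof.
move=> tI tJ.
have mcons (f : n.+1.-tuple T -> \bar R) : measurable_fun setT f ->
    measurable_fun setT (fun p : T * n.-tuple T => f (cons_tuple p.1 p.2)).
  by move=> mf; apply: measurableT_comp => //; exact: measurable_cons_pair.
have mJ (f : n.+1.-tuple T -> \bar R) : measurable_fun setT f -> (forall x, 0 <= f x)%E ->
    measurable_fun setT (fun x => J (fun y => f (cons_tuple x y))).
  move=> mf f0; apply: (tf_meas tJ (f := fun x y => f (cons_tuple x y))) => //.
  exact: mcons.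
have mx (f : n.+1.-tuple T -> \bar R) x : measurable_fun setT f ->
    measurable_fun setT (fun y => f (cons_tuple x y)).
  move=> mf; apply: measurableT_comp => //; exact: measurable_cons_pair.
split=> //.
- move=> f g f0 fg; apply: (tf_le tI) => x.
    by apply: (tf_ge0 tJ).
  by apply: (tf_le tJ).
- move=> f g mf mg f0 g0; rewrite -(tf_add tI) => //; last 4 first.
  + exact: mJ.
  + exact: mJ.
  + by move=> x; apply: (tf_ge0 tJ).
  + by move=> x; apply: (tf_ge0 tJ).
  congr I; apply/funext => x; rewrite -(tf_add tJ)//; exact: mx.
- move=> c f c0 mf f0; rewrite -(tf_scale tI) => //; last 2 first.
  + exact: mJ.
  + by move=> x; apply: (tf_ge0 tJ).
  congr I; apply/funext => x; rewrite -(tf_scale tJ)//; exact: mx.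
- move=> d' A f mf f0.
  apply: (tf_meas tI (f := fun a x => J (fun y => f a (cons_tuple x y)))); last first.
    by move=> a x; apply: (tf_ge0 tJ).
  apply: (tf_meas tJ (f := fun (p : A * T) y => f p.1 (cons_tuple p.2 y))); last by [].
  rewrite (_ : (fun p => _) = (fun q : A * n.+1.-tuple T => f q.1 q.2) \o
     (fun p : A * T * n.-tuple T => (p.1.1, cons_tuple p.1.2 p.2)))//.
  apply: measurableT_comp => //; apply: measurable_fun_pair.
    by apply: measurableT_comp => //.
  by apply: measurable_cons_pair => //; apply: measurableT_comp.
Qed.

(** The integral is a supremum over the simple functions below the integrand, and a larger integrand
    admits more of them. *)
Lemma ge0_le_integral_nomeas {d} {T : measurableType d} {R : realType}
    (mu : {measure set T -> \bar R}) (f g : T -> \bar R) :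
  (forall x, 0 <= f x)%E -> (forall x, f x <= g x)%E ->
  (\int[mu]_x f x <= \int[mu]_x g x)%E.
Proof.
move=> f0 fg; rewrite ge0_integralTE// ge0_integralTE//; last first.
  by move=> x; exact: le_trans (fg x).
apply: le_ereal_sup => _ [h hf <-]; exists h => // x; exact: le_trans (fg x).
Qed.

Section iterated.
Variable R : realType.

Lemma tonelli_functional_lebesgue :
  tonelli_functional (fun f : R -> \bar R => \int[@lebesgue_measure R]_x f x)%E.
Proof.
split.
- exact: (ge0_le_integral_nomeas (@lebesgue_measure R)).
- by move=> f g mf mg f0 g0; rewrite ge0_integralD.
- by move=> c f c0 mf f0; rewrite ge0_integralZl//.
- move=> d' A f mf f0.
  exact: (@measurable_fun_fubini_tonelli_F _ _ _ _ _ (@lebesgue_measure R) (fun p => f p.1 p.2)).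
Qed.

Lemma tonelli_functional_iint d : tonelli_functional (@iint R d).
Proof.
elim: d => [|d IH]; first exact: tonelli_functional_nil.
exact: (tonelli_functional_cons tonelli_functional_lebesgue IH).
Qed.

Lemma tonelli_functional_sint d n : tonelli_functional (@sint R d n).
Proof.
elim: n => [|n IH]; first exact: tonelli_functional_nil.
apply: (@tonelli_functional_cons R _ _ n (@iint R d)) => //.
exact: tonelli_functional_iint.
Qed.

End iterated.

(** * Translation invariance and the one-dimensional Gaussian density *)

Section gaussian.
Variable R : realType.
Implicit Types (f : R -> \bar R) (a x : R).

Lemma ge0_integral_shift f a : measurable_fun setT f -> (forall x, 0 <= f x)%E ->
  (\int[@lebesgue_measure R]_x f (x + a)%R = \int[@lebesgue_measure R]_x f x)%E.
Proof.
move=> mf f0; pose s : measurableTypeR R -> measurableTypeR R := fun x => (x : R) + a.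
have ms : measurable_fun setT s.
  by rewrite /s; apply: (@measurable_funD _ (measurableTypeR R) R setT idfun (cst a)); [exact: measurable_id|exact: measurable_cst].
transitivity (\int[pushforward (@lebesgue_measure R) s]_x f x)%E.
  by have := @ge0_integral_pushforward _ _ _ _ R s ms (@lebesgue_measure R) setT f measurableT mf (fun x _ => f0 x); rewrite preimage_setT => ->.
apply: eq_measure_integral => //= A mA _; apply/esym/lebesgue_measure_unique => //= _ [[b c]] _ <-.
rewrite /pushforward /= (_ : s @^-1` _ = `]b - a, c - a]%classic); last first.
  by apply/seteqP; split => x /=; rewrite !in_itv/= /s ltrBlDr lerBrDr.
rewrite !lebesgue_measure_itv/= !lte_fin ltrD2r; case: ifP => // _.
by rewrite -!EFinB; congr (_%:E); ring.
Qed.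

Lemma phi1E x : phi1 x = normal_pdf 0 1 x.
Proof.
rewrite /phi1 normal_pdfE ?oner_eq0// /normal_fun /normal_peak.
by rewrite subr0 expr1n mul1r mulrC.
Qed.

Lemma phi1_ge0 x : 0 <= phi1 x.
Proof. by rewrite phi1E normal_pdf_ge0. Qed.

Lemma measurable_phi1 : measurable_fun setT (@phi1 R).
Proof.
rewrite (_ : @phi1 R = normal_pdf 0 1); last by apply/funext => x; exact: phi1E.
exact: measurable_normal_pdf.
Qed.

Lemma integral_phi1 a : (\int[@lebesgue_measure R]_x (phi1 (x - a)%R)%:E = 1)%E.
Proof.
rewrite (@ge0_integral_shift (fun x => (phi1 x)%:E) (- a)) => //; last 2 first.
- by apply/measurable_EFinP; exact: measurable_phi1.
- by move=> x; rewrite lee_fin phi1_ge0.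
under eq_integral do rewrite phi1E.
by rewrite integral_normal_pdf ?oner_eq0.
Qed.

End gaussian.

(** * Givens rotations *)

Section euclidean.
Variable R : realType.
Local Notation pt d := (d.-tuple R).

Definition dot d (x y : pt d) : R := \sum_(i < d) tnth x i * tnth y i.

Definition tl d (x : pt d.+1) : pt d := behead_tuple x.

Lemma thead_cons d (a : R) (x : pt d) : thead (cons_tuple a x) = a.
Proof. by []. Qed.

Lemma behead_cons d (a : R) (x : pt d) : tl (cons_tuple a x) = x.
Proof. exact: val_inj. Qed.

Lemma cons_eta d (x : pt d.+1) : cons_tuple (thead x) (tl x) = x.
Proof. by case/tupleP: x => a x; apply: val_inj. Qed.

Lemma tnth_behead_lift d (x : pt d.+1) i : tnth (tl x) i = tnth x (lift ord0 i).
Proof. by rewrite -[in RHS](cons_eta x) tnthS. Qed.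

Lemma dot_recl d (x y : pt d.+1) :
  dot x y = thead x * thead y + dot (tl x) (tl y).
Proof.
rewrite /dot big_ord_recl; congr (_ + _).
by apply: eq_bigr => i _; rewrite !tnth_behead_lift.
Qed.

Lemma dotC d (x y : pt d) : dot x y = dot y x.
Proof. by apply: eq_bigr => i _; rewrite mulrC. Qed.

Lemma dot_ge0 d (x : pt d) : 0 <= dot x x.
Proof. by apply: sumr_ge0 => i _; rewrite -expr2 sqr_ge0. Qed.

Lemma dot_eq0 d (x : pt d) : dot x x = 0 -> forall i, tnth x i = 0.
Proof.
move=> /eqP; rewrite /dot psumr_eq0; last by move=> i _; rewrite -expr2 sqr_ge0.
by move=> /allP x0 i; move: (x0 i); rewrite mem_index_enum mulf_eq0 orbb => /(_ isT)/eqP.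
Qed.

Definition zerov d : pt d := [tuple 0 | _ < d].

Lemma dot0l d (x : pt d) : dot (zerov d) x = 0.
Proof. by apply: big1 => i _; rewrite tnth_mktuple mul0r. Qed.

Lemma dot_zerov d (x : pt d) : dot x x = 0 -> x = zerov d.
Proof. by move=> x0; apply: eq_from_tnth => i; rewrite tnth_mktuple dot_eq0. Qed.

Lemma behead_zerov d : tl (zerov d.+1) = zerov d.
Proof. by apply: eq_from_tnth => i; rewrite tnth_behead_lift !tnth_mktuple. Qed.

Lemma dot_tsubl d (x y z : pt d) : dot (tsub x y) z = dot x z - dot y z.
Proof. by rewrite /dot -sumrB; apply: eq_bigr => i _; rewrite tnth_mktuple mulrBl. Qed.

Lemma dot_tsubr d (x y z : pt d) : dot z (tsub x y) = dot z x - dot z y.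
Proof. by rewrite dotC dot_tsubl !(dotC _ z). Qed.

Definition tscale d (c : R) (x : pt d) : pt d := [tuple c * tnth x i | i < d].

Lemma dot_tscalel d c (x y : pt d) : dot (tscale c x) y = c * dot x y.
Proof. by rewrite /dot mulr_sumr; apply: eq_bigr => i _; rewrite tnth_mktuple mulrA. Qed.

Lemma dot_tscaler d c (x y : pt d) : dot y (tscale c x) = c * dot y x.
Proof. by rewrite dotC dot_tscalel dotC. Qed.

Lemma euclE d (x : pt d) : eucl x = Num.sqrt (dot x x).
Proof. by congr Num.sqrt; apply: eq_bigr => i _; rewrite expr2. Qed.

Lemma eucl_ge0 d (x : pt d) : 0 <= eucl x.
Proof. exact: sqrtr_ge0. Qed.

Lemma sqr_eucl d (x : pt d) : eucl x ^+ 2 = dot x x.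
Proof. by rewrite euclE sqr_sqrtr// dot_ge0. Qed.

Lemma eucl_le d (x : pt d) c : 0 <= c -> dot x x <= c ^+ 2 -> eucl x <= c.
Proof. by move=> c0 h; rewrite -(@ler_pXn2r _ 2) ?nnegrE ?eucl_ge0// sqr_eucl. Qed.

(** With a, b the norms of x, y, expanding the squared norm of b x - a y gives ab(ab - <x, y>) >= 0;
    if ab = 0, one of the vectors is zero. *)
Lemma dot_le_eucl d (x y : pt d) : dot x y <= eucl x * eucl y.
Proof.
have := dot_ge0 (tsub (tscale (eucl y) x) (tscale (eucl x) y)).
rewrite !(dot_tsubl, dot_tsubr, dot_tscalel, dot_tscaler) -!sqr_eucl (dotC y x).
set a := eucl x; set b := eucl y => h.
have a0 : 0 <= a by exact: eucl_ge0.
have b0 : 0 <= b by exact: eucl_ge0.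
have {}h : 0 <= (a * b) * (a * b - dot x y) by nra.
have [ab0|ab0] := ltP 0 (a * b); first by rewrite -subr_ge0 -(pmulr_rge0 _ ab0).
have ab : a * b = 0 by apply/eqP; rewrite eq_le ab0 mulr_ge0.
rewrite ab; move/eqP: ab; rewrite mulf_eq0 => /orP[]/eqP e.
  have : dot x x = 0 by rewrite -sqr_eucl -/a e expr0n.
  by move=> /dot_zerov ->; rewrite dot0l.
have : dot y y = 0 by rewrite -sqr_eucl -/b e expr0n.
by move=> /dot_zerov ->; rewrite dotC dot0l.
Qed.

Lemma normr_dot_le d (x y : pt d) : `|dot x y| <= eucl x * eucl y.
Proof.
rewrite ler_norml dot_le_eucl andbT lerNl.
have := dot_le_eucl (tscale (-1) x) y.
rewrite dot_tscalel mulN1r => /le_trans; apply.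
by rewrite !euclE dot_tscalel dot_tscaler mulrA mulrNN !mul1r.
Qed.

Lemma eucl_tsub_triangle d (x y z : pt d) :
  eucl (tsub x z) <= eucl (tsub x y) + eucl (tsub y z).
Proof.
apply: eucl_le; first by rewrite addr_ge0 ?eucl_ge0.
rewrite sqrrD !sqr_eucl.
have := dot_le_eucl (tsub x y) (tsub y z).
rewrite !(dot_tsubl, dot_tsubr) (dotC y x) (dotC z x) (dotC z y) mulr2n.
nra.
Qed.

End euclidean.

Section givens.
Variable R : realType.
Local Notation pt d := (d.-tuple R).

(** Cosine and, below, sine of a rotation that takes (u, v) to the first axis. For [v = 0] it is the
    identity whatever the sign of [u], so that a rotation with zero sine is never a half turn; the
    decomposition into shears needs a nonzero sine. *)
Definition rotc (u v : R) := if v == 0 then 1 else u / Num.sqrt (u ^+ 2 + v ^+ 2).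
Definition rots (u v : R) := if v == 0 then 0 else v / Num.sqrt (u ^+ 2 + v ^+ 2).

Lemma rot_norm_gt0 (u v : R) : v != 0 -> 0 < u ^+ 2 + v ^+ 2.
Proof. by move=> v0; rewrite ltr_wpDl ?sqr_ge0// exprn_even_gt0. Qed.

Lemma rot_sqr u v : rotc u v ^+ 2 + rots u v ^+ 2 = 1.
Proof.
rewrite /rotc /rots; have [_|v0] := eqVneq v 0; first by rewrite expr1n expr0n addr0.
have n0 := rot_norm_gt0 u v0.
by rewrite !exprMn exprVn sqr_sqrtr ?ltW// -mulrDl divff// gt_eqF.
Qed.

Lemma rot_kill u v : - rots u v * u + rotc u v * v = 0.
Proof.
rewrite /rotc /rots; have [->|v0] := eqVneq v 0; first by rewrite oppr0 mul0r mulr0 addr0.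
by ring.
Qed.

Lemma rot_sin_neq0 u v : rots u v != 0 \/ (rots u v = 0 /\ rotc u v = 1).
Proof.
rewrite /rotc /rots; have [_|v0] := eqVneq v 0; first by right.
left; rewrite mulf_neq0// invr_eq0 gt_eqF// sqrtr_gt0; exact: rot_norm_gt0.
Qed.

(* [givens v] is a product of rotations in adjacent coordinate planes which
   maps [v] to a multiple of the first basis vector. *)
Fixpoint givens d : pt d.+1 -> pt d.+1 -> pt d.+1 :=
  match d with
  | 0 => fun v x => x
  | d'.+1 => fun v x =>
      let w := givens (tl v) (tl v) in
      let y := givens (tl v) (tl x) in
      let c := rotc (thead v) (thead w) in
      let s := rots (thead v) (thead w) in
      cons_tuple (c * thead x + s * thead y)
        (cons_tuple (- s * thead x + c * thead y) (tl y))
  end.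

Fixpoint givens_inv d : pt d.+1 -> pt d.+1 -> pt d.+1 :=
  match d with
  | 0 => fun v x => x
  | d'.+1 => fun v z =>
      let w := givens (tl v) (tl v) in
      let c := rotc (thead v) (thead w) in
      let s := rots (thead v) (thead w) in
      let z1 := thead (tl z) in
      cons_tuple (c * thead z - s * z1)
        (givens_inv (tl v)
           (cons_tuple (s * thead z + c * z1) (tl (tl z))))
  end.

Lemma dot_givens_adj d (v x z : pt d.+1) : dot (givens v x) z = dot x (givens_inv v z).
Proof.
elim: d v x z => [|d IH] v x z //=.
rewrite dot_recl [in RHS]dot_recl !thead_cons !behead_cons -IH dot_recl.
rewrite !thead_cons !behead_cons [in RHS]dot_recl !thead_cons !behead_cons; ring.
Qed.

Lemma givens_invK d (v z : pt d.+1) : givens v (givens_inv v z) = z.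
Proof.
elim: d v z => [|d IH] v z //=.
rewrite !behead_cons IH !thead_cons !behead_cons.
set c := rotc _ _; set s := rots _ _.
have cs : c ^+ 2 + s ^+ 2 = 1 by exact: rot_sqr.
rewrite -[RHS]cons_eta; congr cons_tuple.
  transitivity ((c ^+ 2 + s ^+ 2) * thead z); first by ring.
  by rewrite cs mul1r.
rewrite -[RHS]cons_eta; congr cons_tuple.
transitivity ((c ^+ 2 + s ^+ 2) * thead (tl z)); first by ring.
by rewrite cs mul1r.
Qed.

Lemma givensK d (v x : pt d.+1) : givens_inv v (givens v x) = x.
Proof.
elim: d v x => [|d IH] v x //=.
rewrite !(behead_cons, thead_cons).
set c := rotc _ _; set s := rots _ _; set y := givens _ (tl x).
have cs : c ^+ 2 + s ^+ 2 = 1 by exact: rot_sqr.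
rewrite -[RHS]cons_eta; congr cons_tuple.
  transitivity ((c ^+ 2 + s ^+ 2) * thead x); first by ring.
  by rewrite cs mul1r.
rewrite -[RHS](IH (tl v)) -/y -[in RHS](cons_eta y); congr givens_inv.
congr cons_tuple.
transitivity ((c ^+ 2 + s ^+ 2) * thead y); first by ring.
by rewrite cs mul1r.
Qed.

Lemma dot_givens d (v x y : pt d.+1) : dot (givens v x) (givens v y) = dot x y.
Proof. by rewrite dot_givens_adj givensK. Qed.

Lemma behead_givens_self d (v : pt d.+1) : tl (givens v v) = zerov R d.
Proof.
elim: d v => [|d IH] v; first by apply: eq_from_tnth => -[].
rewrite /= behead_cons IH.
rewrite rot_kill -[RHS]cons_eta behead_zerov; congr cons_tuple.
by rewrite /thead tnth_mktuple.
Qed.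

End givens.

(** * Shears and rotations of the plane preserve Lebesgue measure *)

Section rotation.
Variable R : realType.
Local Notation mu := (@lebesgue_measure R).
Implicit Types (f : R -> R -> \bar R).

Definition measurable_fun2 f := measurable_fun setT (fun p : R * R => f p.1 p.2).

Lemma measurable_fun2_comp f (u v : R * R -> R) : measurable_fun2 f ->
  measurable_fun setT u -> measurable_fun setT v ->
  measurable_fun2 (fun x y => f (u (x, y)) (v (x, y))).
Proof.
move=> mf m1 m2; rewrite /measurable_fun2.
rewrite (_ : (fun p => _) = (fun p : R * R => f p.1 p.2) \o (fun p => (u p, v p))); last first.
  by apply/funext => -[x y].
by apply: measurableT_comp => //; exact: measurable_fun_pair.
Qed.

Lemma ge0_integral2_shear1 f (a : R) : measurable_fun2 f -> (forall x y, 0 <= f x y)%E ->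
  (\int[mu]_x \int[mu]_y f (x + a * y)%R y = \int[mu]_x \int[mu]_y f x y)%E.
Proof.
move=> mf f0.
have m2 : measurable_fun2 (fun x y => f (x + a * y) y).
  apply: (measurable_fun2_comp (u := fun p => p.1 + a * p.2) (v := snd) mf) => //.
  by apply: measurable_funD => //; exact: measurable_funM.
apply: (etrans (@fubini_tonelli _ _ _ _ _ mu mu (fun p => f (p.1 + a * p.2)%R p.2) m2
  (fun p => f0 _ _))).
apply: (etrans _ (esym (@fubini_tonelli _ _ _ _ _ mu mu (fun p => f p.1 p.2) mf
  (fun p => f0 _ _)))).
apply: eq_integral => y _ /=.
apply: (@ge0_integral_shift R (fun x => f x y)) => //.
exact: (measurable_fun_pair1 y mf).
Qed.

Lemma ge0_integral2_shear2 f (a : R) : measurable_fun2 f -> (forall x y, 0 <= f x y)%E ->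
  (\int[mu]_x \int[mu]_y f x (y + a * x)%R = \int[mu]_x \int[mu]_y f x y)%E.
Proof.
move=> mf f0; apply: eq_integral => x _.
apply: (@ge0_integral_shift R (fun y => f x y)) => //.
exact: (measurable_fun_pair2 x mf).
Qed.

(* A rotation by an angle with nonzero sine is a product of three shears. *)
Lemma ge0_integral2_rot f (c s : R) : c ^+ 2 + s ^+ 2 = 1 -> s != 0 ->
  measurable_fun2 f -> (forall x y, 0 <= f x y)%E ->
  (\int[mu]_x \int[mu]_y f (c * x + s * y)%R (- s * x + c * y)%R
   = \int[mu]_x \int[mu]_y f x y)%E.
Proof.
(* [a] is the tangent of half the angle. The shears by [a], [- s], [a] compose to the rotation
   because a s = 1 - c and a (2 - a s) = s. *)
move=> cs s0 mf f0; pose a := (1 - c) / s.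
have m1 : measurable_fun2 (fun x y => f (x + a * y) y).
  apply: (measurable_fun2_comp (u := fun p => p.1 + a * p.2) (v := snd) mf) => //.
  by apply: measurable_funD => //; exact: measurable_funM.
have m2 : measurable_fun2 (fun x y => f (x + a * (y + - s * x)) (y + - s * x)).
  apply: (measurable_fun2_comp (u := fst) (v := fun p => p.2 + - s * p.1) m1) => //.
  by apply: measurable_funD => //; exact: measurable_funM.
have S1 := @ge0_integral2_shear1 f a mf f0.
have S2 := @ge0_integral2_shear2 (fun x y => f (x + a * y) y) (- s) m1 (fun _ _ => f0 _ _).
have S3 := @ge0_integral2_shear1 (fun x y => f (x + a * (y + - s * x)) (y + - s * x)) a m2
  (fun _ _ => f0 _ _).
apply: etrans (etrans S3 (etrans S2 S1)).
have as1 : a * s = 1 - c by rewrite /a divfK.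
have ac : a * (2 - (1 - c)) = s.
  rewrite (_ : 2 - (1 - c) = 1 + c); last by ring.
  rewrite /a mulrAC (_ : (1 - c) * (1 + c) = s ^+ 2); first by rewrite expr2 mulfK.
  by move/eqP: cs; rewrite eq_sym addrC -subr_eq => /eqP <-; ring.
apply: eq_integral => x _; apply: eq_integral => y _.
congr f.
- rewrite (_ : x + _ + _ = (1 - a * s) * x + a * (2 - a * s) * y); last by ring.
  by rewrite as1 ac; ring.
- rewrite (_ : y + _ = - s * x + (1 - a * s) * y); last by ring.
  by rewrite as1; ring.
Qed.

End rotation.

(** * Measurability of the rotations in the vectors that define them *)

Section measurability.
Variable R : realType.
Local Notation pt d := (d.-tuple R).
Context {d} {A : measurableType d}.

Lemma measurable_tnth_comp n (x : A -> pt n) i :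
  measurable_fun setT x -> measurable_fun setT (fun a => tnth (x a) i).
Proof. by move=> /measurable_fun_tnthP/(_ i). Qed.

Lemma measurable_tl n (x : A -> pt n.+1) :
  measurable_fun setT x -> measurable_fun setT (fun a => tl (x a)).
Proof.
move=> mx; apply/measurable_fun_tnthP => i.
rewrite (_ : _ \o _ = fun a => tnth (x a) (lift ord0 i)).
  exact: measurable_tnth_comp.
by apply/funext => a /=; rewrite tnth_behead_lift.
Qed.

Lemma measurable_thead n (x : A -> pt n.+1) :
  measurable_fun setT x -> measurable_fun setT (fun a => thead (x a)).
Proof. exact: measurable_tnth_comp. Qed.

Lemma measurable_sqrt_comp (f : A -> R) : (forall a, 0 <= f a) ->
  measurable_fun setT f -> measurable_fun setT (fun a => Num.sqrt (f a)).
Proof.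
move=> f0 mf; rewrite (_ : (fun a => _) = (fun r => r `^ (2^-1)) \o f).
  by apply: measurableT_comp => //; exact: measurable_powR.
by apply/funext => a /=; rewrite powR12_sqrt.
Qed.

Lemma measurable_isqrt (f : A -> R) : (forall a, 0 <= f a) ->
  measurable_fun setT f -> measurable_fun setT (fun a => (Num.sqrt (f a))^-1).
Proof.
move=> f0 mf; rewrite (_ : (fun a => _) = (fun r => r `^ (- 2^-1)) \o f).
  by apply: measurableT_comp => //; exact: measurable_powR.
by apply/funext => a /=; rewrite powRN powR12_sqrt.
Qed.

Lemma measurable_rot_isqrt (u v : A -> R) :
  measurable_fun setT u -> measurable_fun setT v ->
  measurable_fun setT (fun a => (Num.sqrt (u a ^+ 2 + v a ^+ 2))^-1).
Proof.
move=> mu mv; apply: measurable_isqrt; first by move=> a; rewrite addr_ge0 ?sqr_ge0.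
by apply: measurable_funD; apply: measurable_funX.
Qed.

Lemma measurable_rotc (u v : A -> R) :
  measurable_fun setT u -> measurable_fun setT v ->
  measurable_fun setT (fun a => rotc (u a) (v a)).
Proof.
move=> mu mv; apply: measurable_fun_ifT => //.
  by apply: measurable_fun_eqr.
by apply: measurable_funM => //; exact: measurable_rot_isqrt.
Qed.

Lemma measurable_rots (u v : A -> R) :
  measurable_fun setT u -> measurable_fun setT v ->
  measurable_fun setT (fun a => rots (u a) (v a)).
Proof.
move=> mu mv; apply: measurable_fun_ifT => //.
  by apply: measurable_fun_eqr.
by apply: measurable_funM => //; exact: measurable_rot_isqrt.
Qed.

Lemma measurable_givens n (v x : A -> pt n.+1) :
  measurable_fun setT v -> measurable_fun setT x ->
  measurable_fun setT (fun a => givens (v a) (x a)).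
Proof.
elim: n v x => [|n IH] v x mv mx //=.
have mv' := measurable_tl mv; have mx' := measurable_tl mx.
have mw := measurable_thead (IH _ _ mv' mv'); have my := IH _ _ mv' mx'.
have mc := measurable_rotc (measurable_thead mv) mw.
have ms := measurable_rots (measurable_thead mv) mw.
apply: measurable_cons_pair.
  apply: measurable_funD; apply: measurable_funM => //; exact: measurable_thead.
apply: measurable_cons_pair; last exact: measurable_tl.
apply: measurable_funD; apply: measurable_funM => //; try exact: measurable_thead.
exact: measurable_funN.
Qed.

Lemma measurable_givens_inv n (v x : A -> pt n.+1) :
  measurable_fun setT v -> measurable_fun setT x ->
  measurable_fun setT (fun a => givens_inv (v a) (x a)).
Proof.
elim: n v x => [|n IH] v x mv mx //=.
have mv' := measurable_tl mv; have mx' := measurable_tl mx.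
have mw := measurable_thead (measurable_givens mv' mv').
have mc := measurable_rotc (measurable_thead mv) mw.
have ms := measurable_rots (measurable_thead mv) mw.
have mx0 := measurable_thead mx; have mx1 := measurable_thead mx'.
apply: measurable_cons_pair.
  by apply: measurable_funB; apply: measurable_funM.
apply: IH => //; apply: measurable_cons_pair; last exact: measurable_tl.
by apply: measurable_funD; apply: measurable_funM.
Qed.

End measurability.

Section givens_invariance.
Variable R : realType.
Local Notation pt d := (d.-tuple R).
Local Notation mu := (@lebesgue_measure R).

Lemma iint_cons d (f : pt d.+1 -> \bar R) :
  iint f = (\int[mu]_x iint (fun y => f (cons_tuple x y)))%E.
Proof. by []. Qed.

(** The rotation of the tail is measure preserving by induction; what remains is a rotation of the
    first two coordinates, with the others integrated out in [F]. If its sine is zero it is the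
    identity. *)
Lemma iint_givens d (v : pt d.+1) (f : pt d.+1 -> \bar R) :
  measurable_fun setT f -> (forall x, 0 <= f x)%E ->
  iint (fun x => f (givens v x)) = iint f.
Proof.
elim: d v f => [|d IH] v f mf f0; first by [].
rewrite iint_cons.
set w := givens (tl v) (tl v); set c := rotc (thead v) (thead w).
set s := rots (thead v) (thead w).
pose g (x : R) (y : pt d.+1) := f (cons_tuple (c * x + s * thead y)
   (cons_tuple (- s * x + c * thead y) (tl y))).
have mg x : measurable_fun setT (g x).
  apply: measurableT_comp => //.
  have mth := measurable_thead (@measurable_id _ (pt d.+1) setT).
  apply: measurable_cons_pair.
    by apply: measurable_funD => //; exact: measurable_funM.
  apply: measurable_cons_pair; last exact: (measurable_tl (@measurable_id _ (pt d.+1) setT)).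
  by apply: measurable_funD => //; exact: measurable_funM.
transitivity (\int[mu]_x iint (fun y => g x (givens (tl v) y)))%E.
  apply: eq_integral => x _; congr iint; apply/funext => y.
  by rewrite /= !behead_cons.
transitivity (\int[mu]_x iint (fun y => g x y))%E.
  by apply: eq_integral => x _; rewrite IH// => y; exact: f0.
pose F (x y : R) := iint (fun z : pt d => f (cons_tuple x (cons_tuple y z))).
have mF : measurable_fun2 F.
  rewrite /measurable_fun2 /F.
  apply: (tf_meas (tonelli_functional_iint R d)
     (f := fun (p : R * R) z => f (cons_tuple p.1 (cons_tuple p.2 z)))) => //.
  apply: measurableT_comp => //; apply: measurable_cons_pair.
    by apply: measurableT_comp => //.
  by apply: measurable_cons_pair => //; apply: measurableT_comp.
have F0 x y : (0 <= F x y)%E by apply: (tf_ge0 (tonelli_functional_iint R d)).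
transitivity (\int[mu]_x \int[mu]_y F (c * x + s * y)%R (- s * x + c * y)%R)%E.
  apply: eq_integral => x _; rewrite iint_cons; apply: eq_integral => y _.
  by rewrite /g /F; congr iint; apply/funext => z; rewrite behead_cons.
transitivity (\int[mu]_x \int[mu]_y F x y)%E; last by [].
have [s0|[s0 c1]] := rot_sin_neq0 (thead v) (thead w).
  by apply: ge0_integral2_rot => //; exact: rot_sqr.
apply: eq_integral => x _; apply: eq_integral => y _.
by rewrite /s /c s0 c1 oppr0 !mul0r !mul1r add0r addr0.
Qed.

End givens_invariance.

(** The constant may be infinite, in which case monotonicity puts the left side above every real.
    This serves the base case of [iint_qrproj], where the integrand has the constant value [f
    [tuple]]. *)
Lemma tf_scale_unit {d} {T : measurableType d} {R : realType} (I : (T -> \bar R) -> \bar R)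
    (f : T -> \bar R) (c : \bar R) :
  tonelli_functional I -> measurable_fun setT f -> (forall x, 0 <= f x)%E -> (0 <= c)%E ->
  I f = 1%E -> I (fun x => c * f x)%E = c.
Proof.
move=> tI mf f0 c0 If; case: c c0 => [c||]// c0.
  by rewrite (tf_scale tI)// If mule1.
apply: eq_infty => r.
have [r0|r0] := leP r 0.
  by apply: (@le_trans _ _ 0%E); rewrite ?lee_fin//; apply: (tf_ge0 tI) => x; rewrite mule_ge0.
rewrite -[r%:E]mule1 -If -(tf_scale tI)//; last exact: ltW.
apply: (tf_le tI) => x; first by rewrite mule_ge0// lee_fin ltW.
by rewrite lee_wpmul2r// leey.
Qed.

(** * Gaussian mixtures and the Hellinger distance *)

Section gaussian_density.
Variable R : realType.
Local Notation pt d := (d.-tuple R).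

Lemma phidE d (x : pt d) :
  phid x = expR (- (dot x x) / 2) * (Num.sqrt (pi *+ 2))^-1 ^+ d.
Proof.
rewrite /phid /phi1 big_split/= prodr_const card_ord; congr (_ * _).
rewrite -expR_sum; congr expR.
by rewrite /dot -sumrN mulr_suml; apply: eq_bigr => i _; rewrite expr2.
Qed.

Lemma phid_ge0 d (x : pt d) : 0 <= phid x.
Proof. by apply: prodr_ge0 => i _; exact: phi1_ge0. Qed.

Lemma phid_givens d (v x a : pt d.+1) : phid (tsub (givens v x) (givens v a)) = phid (tsub x a).
Proof. by rewrite !phidE !(dot_tsubl, dot_tsubr) !dot_givens. Qed.

Lemma phid_cons d (x0 : R) (x : pt d) (a : pt d.+1) :
  phid (tsub (cons_tuple x0 x) a) = phi1 (x0 - thead a) * phid (tsub x (tl a)).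
Proof.
rewrite /phid big_ord_recl tnth_mktuple; congr (_ * _).
apply: eq_bigr => i _; congr phi1.
by rewrite !tnth_mktuple tnthS tnth_behead_lift.
Qed.

(** Completing the square: an exponential tilt by [u] moves the centre of the Gaussian from [a] to a
    + u, written here as [tsub a (tscale (-1) u)]. *)
Lemma expR_dot_phid d (u x a : pt d) :
  expR (dot u x) * phid (tsub x a) =
  expR (dot u a + dot u u / 2) * phid (tsub x (tsub a (tscale (-1) u))).
Proof.
rewrite !phidE !mulrA -!expRD; congr (expR _ * _).
rewrite !(dot_tsubl, dot_tsubr, dot_tscalel, dot_tscaler) (dotC a u) (dotC x u) (dotC x a).
by field.
Qed.

Lemma measurable_tsub {d'} {A : measurableType d'} d (x y : A -> pt d) :
  measurable_fun setT x -> measurable_fun setT y ->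
  measurable_fun setT (fun a => tsub (x a) (y a)).
Proof.
move=> mx my; apply/measurable_fun_tnthP => i.
rewrite (_ : _ \o _ = fun a => tnth (x a) i - tnth (y a) i).
  by apply: measurable_funB; exact: measurable_tnth_comp.
by apply/funext => a /=; rewrite tnth_mktuple.
Qed.

Lemma measurable_phid {d'} {A : measurableType d'} d (x : A -> pt d) :
  measurable_fun setT x -> measurable_fun setT (fun a => phid (x a)).
Proof.
move=> mx; apply: measurable_prod => i _.
by apply: (measurableT_comp (@measurable_phi1 R)); exact: measurable_tnth_comp.
Qed.

Lemma measurable_dot {d'} {A : measurableType d'} d (x y : A -> pt d) :
  measurable_fun setT x -> measurable_fun setT y ->
  measurable_fun setT (fun a => dot (x a) (y a)).
Proof.
move=> mx my; apply: measurable_sum => i.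
by apply: measurable_funM; exact: measurable_tnth_comp.
Qed.

Lemma iint_phid d (a : pt d) : iint (fun x => (phid (tsub x a))%:E) = 1%E.
Proof.
elim: d a => [|d IH] a; first by rewrite /= /phid big_ord0.
rewrite iint_cons -(integral_phi1 (thead a)); apply: eq_integral => x _.
transitivity (iint (fun y => (phi1 (x - thead a))%:E * (phid (tsub y (tl a)))%:E)%E).
  by congr iint; apply/funext => y; rewrite phid_cons EFinM.
rewrite (tf_scale (tonelli_functional_iint R d))//.
- by rewrite IH mule1.
- exact: phi1_ge0.
- apply/measurable_EFinP; apply: measurable_phid; apply: measurable_tsub => //.
- by move=> y; rewrite lee_fin phid_ge0.
Qed.

Lemma iint_expR_dot_phid d (u a : pt d) :
  iint (fun x => (expR (dot u x) * phid (tsub x a))%:E) = (expR (dot u a + dot u u / 2))%:E.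
Proof.
under [X in iint X]funext => x do rewrite expR_dot_phid EFinM.
rewrite (tf_scale (tonelli_functional_iint R d)) ?expR_ge0//.
- by rewrite iint_phid mule1.
- by apply/measurable_EFinP; apply: measurable_phid; exact: measurable_tsub.
- by move=> y; rewrite lee_fin phid_ge0.
Qed.

End gaussian_density.

(** * Orthogonal projection onto a space containing k given vectors *)

Section projection.
Variable R : realType.
Local Notation pt d := (d.-tuple R).

(* Coordinates of [x] in an orthonormal basis, obtained from the QR
   decomposition of the [k] vectors [V], whose span contains every [V j];
   [lift] is the adjoint isometry. *)
Fixpoint qrproj e k : ('I_k -> pt (k + e)) -> pt (k + e) -> pt k :=
  match k with
  | 0 => fun _ _ => [tuple]
  | k'.+1 => fun V x =>
      cons_tuple (thead (givens (V ord0) x))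
        (@qrproj e k' (fun j => tl (givens (V ord0) (V (lift ord0 j)))) (tl (givens (V ord0) x)))
  end.

Fixpoint qrlift e k : ('I_k -> pt (k + e)) -> pt k -> pt (k + e) :=
  match k with
  | 0 => fun _ _ => zerov R e
  | k'.+1 => fun V b =>
      givens_inv (V ord0) (cons_tuple (thead b)
        (@qrlift e k' (fun j => tl (givens (V ord0) (V (lift ord0 j)))) (tl b)))
  end.

Lemma dot_qrproj e k (V : 'I_k -> pt (k + e)) x b : dot (qrproj V x) b = dot x (qrlift V b).
Proof.
elim: k V x b => [|k IH] V x b /=; first by rewrite [RHS]dotC dot0l /dot big_ord0.
rewrite -dot_givens_adj dot_recl [in RHS](@dot_recl _ (k + e)).
by rewrite !behead_cons IH.
Qed.

Lemma qrprojK e k (V : 'I_k -> pt (k + e)) b : qrproj V (qrlift V b) = b.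
Proof.
elim: k V b => [|k IH] V b /=; first by rewrite [b]tuple0.
by rewrite givens_invK thead_cons !behead_cons IH cons_eta.
Qed.

Lemma dot_qrlift e k (V : 'I_k -> pt (k + e)) b c : dot (qrlift V b) (qrlift V c) = dot b c.
Proof. by rewrite -dot_qrproj qrprojK. Qed.

Lemma qrproj0 e k (V : 'I_k -> pt (k + e)) : qrproj V (zerov R (k + e)) = zerov R k.
Proof. by apply: dot_zerov; rewrite dot_qrproj dot0l. Qed.

Lemma qrlift0 e k (V : 'I_k -> pt (k + e)) : qrlift V (zerov R k) = zerov R (k + e).
Proof. by apply: dot_zerov; rewrite dot_qrlift dot0l. Qed.

(** The rotation by [V ord0] annihilates the tail of [V ord0] itself, so its first coordinate loses
    nothing; the tails of the other vectors are those handed to the recursive call. *)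
Lemma qrliftK e k (V : 'I_k -> pt (k + e)) j : qrlift V (qrproj V (V j)) = V j.
Proof.
elim: k V j => [|k IH] V; first by case.
move=> j /=; rewrite thead_cons behead_cons.
have [->|[i ->]] : j = ord0 \/ exists i, j = lift ord0 i.
  by case: (unliftP ord0 j) => [i ->|->]; [right; exists i|left].
  rewrite behead_givens_self qrproj0 qrlift0 -(behead_givens_self (V ord0)).
  by rewrite cons_eta givensK.
rewrite (IH (fun j => tl (givens (V ord0) (V (lift ord0 j)))) i).
by rewrite cons_eta givensK.
Qed.

Lemma measurable_qrproj {d} {A : measurableType d} e k
    (V : A -> 'I_k -> pt (k + e)) (x : A -> pt (k + e)) :
  (forall j, measurable_fun setT (fun a => V a j)) -> measurable_fun setT x ->
  measurable_fun setT (fun a => qrproj (V a) (x a)).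
Proof.
elim: k V x => [|k IH] V x mV mx //=.
apply: measurable_cons_pair; first by apply: measurable_thead; exact: measurable_givens.
apply: (IH (fun a j => tl (givens (V a ord0) (V a (lift ord0 j))))).
  by move=> j; apply: measurable_tl; exact: measurable_givens.
by apply: measurable_tl; exact: measurable_givens.
Qed.

Lemma measurable_qrlift {d} {A : measurableType d} e k
    (V : A -> 'I_k -> pt (k + e)) (x : A -> pt k) :
  (forall j, measurable_fun setT (fun a => V a j)) -> measurable_fun setT x ->
  measurable_fun setT (fun a => qrlift (V a) (x a)).
Proof.
elim: k V x => [|k IH] V x mV mx //=.
apply: measurable_givens_inv => //.
apply: measurable_cons_pair; first exact: measurable_thead.
apply: (IH (fun a j => tl (givens (V a ord0) (V a (lift ord0 j))))).
  by move=> j; apply: measurable_tl; exact: measurable_givens.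
exact: measurable_tl.
Qed.

(** The image of N(a, I) under the projection is N(qrproj V a, I). Each level rotates, which
    preserves both Lebesgue measure and the Gaussian, and splits off the first coordinate; the base
    case integrates out the [e] discarded coordinates. *)
Lemma iint_qrproj e k (V : 'I_k -> pt (k + e)) (a : pt (k + e)) (f : pt k -> \bar R) :
  measurable_fun setT f -> (forall y, 0 <= f y)%E ->
  iint (fun x => f (qrproj V x) * (phid (tsub x a))%:E)%E =
  iint (fun y => f y * (phid (tsub y (qrproj V a)))%:E)%E.
Proof.
have mphi d (b : pt d) : measurable_fun setT (fun x : pt d => (phid (tsub x b))%:E).
  by apply/measurable_EFinP; apply: measurable_phid; exact: measurable_tsub.
have phi0 d (b x : pt d) : (0 <= (phid (tsub x b))%:E)%E by rewrite lee_fin phid_ge0.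
elim: k V a f => [|k IH] V a f mf f0.
  rewrite [RHS]/= [in RHS]/phid big_ord0 mule1.
  exact: (tf_scale_unit (tonelli_functional_iint R e) (mphi e a) (phi0 e a) (f0 [tuple]) (iint_phid a)).
have mc (c : R) : measurable_fun setT (fun z : pt k => f (cons_tuple c z)).
  by apply: measurableT_comp => //; exact: measurable_cons_pair.
pose W := fun j => tl (givens (V ord0) (V (lift ord0 j))).
pose g (z : pt (k + e).+1) :=
  (f (cons_tuple (thead z) (qrproj W (tl z))) * (phid (tsub z (givens (V ord0) a)))%:E)%E.
transitivity (iint (fun x => g (givens (V ord0) x))).
  by congr iint; apply/funext => x; rewrite /g phid_givens.
rewrite iint_givens; last 2 first.
- apply: emeasurable_funM; last exact: mphi.
  apply: measurableT_comp => //; apply: measurable_cons_pair; first exact: measurable_thead.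
  apply: (measurable_qrproj (V := fun=> W)) => //; exact: measurable_tl.
- by move=> x; rewrite mule_ge0.
rewrite iint_cons [in RHS]iint_cons; apply: eq_integral => c _.
set b := givens (V ord0) a.
transitivity (iint (fun x => (phi1 (c - thead b))%:E *
    (f (cons_tuple c (qrproj W x)) * (phid (tsub x (tl b)))%:E))%E).
  congr iint; apply/funext => x; rewrite /g thead_cons behead_cons phid_cons EFinM.
  by rewrite muleCA.
rewrite (tf_scale (tonelli_functional_iint R (k + e)))//; last 3 first.
- exact: phi1_ge0.
- apply: emeasurable_funM; last exact: mphi.
  apply: (measurableT_comp (mc c)).
  by apply: (measurable_qrproj (V := fun=> W)).
- by move=> x; rewrite mule_ge0.
rewrite (IH W (tl b) (fun x => f (cons_tuple c x)))//.
rewrite -(tf_scale (tonelli_functional_iint R k))//; last 3 first.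
- exact: phi1_ge0.
- by apply: emeasurable_funM; [exact: mc|exact: mphi].
- by move=> x; rewrite mule_ge0.
congr iint; apply/funext => x.
by rewrite phid_cons (thead_cons _ _) (behead_cons _ (qrproj W (tl b))) EFinM muleCA.
Qed.

End projection.

(** * Moment generating functions and the Hellinger distance *)

Section hellinger.
Variable R : realType.
Local Notation pt d := (d.-tuple R).
Variables k d : nat.
Implicit Types (G : mix R k d) (u x : pt d).

(** This belongs to the mixing distribution; the mixture carries the extra factor exp(|u|^2/2). *)
Definition mgf G u : R := \sum_j mw G j * expR (dot u (ma G j)).

Lemma mixpdf_ge0 G x : is_mixdist G -> 0 <= mixpdf G x.
Proof. by case=> w0 _; apply: sumr_ge0 => j _; rewrite mulr_ge0// phid_ge0. Qed.

Lemma measurable_mixpdf {d'} {A : measurableType d'} G (x : A -> pt d) :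
  measurable_fun setT x -> measurable_fun setT (fun a => mixpdf G (x a)).
Proof.
move=> mx; apply: measurable_sum => j; apply: measurable_funM => //.
by apply: measurable_phid; exact: measurable_tsub.
Qed.

Lemma iint_mix G (f : pt d -> R) (v : 'I_k -> R) : is_mixdist G ->
  measurable_fun setT f -> (forall x, 0 <= f x) ->
  (forall j, iint (fun x => (f x * phid (tsub x (ma G j)))%:E) = (v j)%:E) ->
  iint (fun x => (f x * mixpdf G x)%:E) = (\sum_j mw G j * v j)%:E.
Proof.
move=> [w0 _] mf f0 hv.
have tI := tonelli_functional_iint R d.
have mp j : measurable_fun setT (fun x : pt d => (f x * phid (tsub x (ma G j)))%:E).
  apply/measurable_EFinP; apply: measurable_funM => //.
  by apply: measurable_phid; exact: measurable_tsub.
transitivity (iint (fun x : pt d => \sum_(j < k) (mw G j)%:E * (f x * phid (tsub x (ma G j)))%:E)%E).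
  congr iint; apply/funext => x; rewrite /mixpdf mulr_sumr -sumEFin.
  by apply: eq_bigr => j _; rewrite -EFinM mulrCA.
rewrite (tf_sum tI); last 2 first.
- by move=> j; apply: emeasurable_funM => //; exact: measurable_cst.
- by move=> j x; rewrite -EFinM lee_fin !mulr_ge0// phid_ge0.
rewrite -sumEFin; apply: eq_bigr => j _; rewrite (tf_scale tI)//; last first.
  by move=> x; rewrite lee_fin mulr_ge0// phid_ge0.
by rewrite hv.
Qed.

Lemma measurable_expR_dot u : measurable_fun setT (fun x : pt d => expR (dot u x)).
Proof.
apply: (@measurableT_comp _ _ _ _ _ _ expR _ (fun x : pt d => dot u x)) => //.
by apply: measurable_dot.
Qed.

Lemma iint_mgf G u : is_mixdist G ->
  iint (fun x => (expR (dot u x) * mixpdf G x)%:E) = (expR (dot u u / 2) * mgf G u)%:E.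
Proof.
move=> Gd; rewrite (iint_mix (v := fun j => expR (dot u (ma G j) + dot u u / 2)))//.
- congr (_%:E); rewrite /mgf mulr_sumr; apply: eq_bigr => j _.
  by rewrite expRD; ring.
- exact: measurable_expR_dot.
- by move=> j; exact: iint_expR_dot_phid.
Qed.

Lemma iint_mixpdf G : is_mixdist G -> iint (fun x => (mixpdf G x)%:E) = 1%E.
Proof.
move=> Gd; have := iint_mix (f := fun=> 1) (v := fun=> 1) Gd (measurable_cst _) (fun=> ler01).
move=> h; transitivity (iint (fun x => (1 * mixpdf G x)%:E)).
  by congr iint; apply/funext => x; rewrite mul1r.
rewrite h.
  by under eq_bigr do rewrite mulr1; have [_ ->] := Gd.
by move=> j; rewrite -(iint_phid (ma G j)); congr iint; apply/funext => x; rewrite mul1r.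
Qed.

Definition sqrt_gap G G' x := (Num.sqrt (mixpdf G x) - Num.sqrt (mixpdf G' x)) ^+ 2.

Lemma measurable_sqrt_gap G G' : is_mixdist G -> is_mixdist G' ->
  measurable_fun setT (fun x => (sqrt_gap G G' x)%:E).
Proof.
move=> Gd Gd'; apply/measurable_EFinP; apply: measurable_funX.
by apply: measurable_funB; apply: measurable_sqrt_comp;
  rewrite ?mixpdf_ge0//; (try by move=> a; exact: mixpdf_ge0); exact: measurable_mixpdf.
Qed.

Lemma hellinger_ge0 G G' : 0 <= hellinger G G'.
Proof. exact: sqrtr_ge0. Qed.

Lemma hellingerC G G' : hellinger G G' = hellinger G' G.
Proof. by congr (Num.sqrt (fine (iint _))); apply/funext => x; rewrite -sqrrN opprB. Qed.

(** The integrand is at most the sum of the two densities, so the integral is at most 2 and [fine]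
    in [hellinger] loses nothing. *)
Lemma sqr_hellinger G G' : is_mixdist G -> is_mixdist G' ->
  ((hellinger G G') ^+ 2)%:E = iint (fun x => (sqrt_gap G G' x)%:E).
Proof.
move=> Gd Gd'; have tI := tonelli_functional_iint R d.
have s0 : (0 <= iint (fun x => (sqrt_gap G G' x)%:E))%E.
  by apply: (tf_ge0 tI) => x; rewrite lee_fin sqr_ge0.
have s1 : (iint (fun x => (sqrt_gap G G' x)%:E) <= 1 + 1)%E.
  rewrite -[X in (_ <= X + _)%E](iint_mixpdf Gd) -[X in (_ <= _ + X)%E](iint_mixpdf Gd').
  rewrite -(tf_add tI); last 4 first.
  - by apply/measurable_EFinP; exact: measurable_mixpdf.
  - by apply/measurable_EFinP; exact: measurable_mixpdf.
  - by move=> x; rewrite lee_fin mixpdf_ge0.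
  - by move=> x; rewrite lee_fin mixpdf_ge0.
  apply: (tf_le tI) => x; first by rewrite lee_fin sqr_ge0.
  rewrite -EFinD lee_fin /sqrt_gap.
  have p0 := mixpdf_ge0 x Gd; have q0 := mixpdf_ge0 x Gd'.
  rewrite -[X in _ <= X + _](sqr_sqrtr p0) -[X in _ <= _ + X](sqr_sqrtr q0).
  have := sqrtr_ge0 (mixpdf G x); have := sqrtr_ge0 (mixpdf G' x); nra.
rewrite /hellinger sqr_sqrtr ?fine_ge0// fineK// ge0_fin_numE//.
by apply: le_lt_trans s1 _; rewrite -EFinD ltry.
Qed.

(* Optimising over [la] in AM-GM replaces Cauchy-Schwarz. *)
Lemma le_amgm_mul (D b h : R) : 0 < b -> 0 <= h ->
  (forall la, 0 < la -> D <= la / 2 * h ^+ 2 + b ^+ 2 / (2 * la)) -> D <= b * h.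
Proof.
move=> b0; rewrite le_eqVlt => /orP[/eqP <-|h0] H.
  rewrite mulr0; apply/ler_addgt0Pr => e e0; rewrite add0r.
  have l0 : 0 < b ^+ 2 / (2 * e) by rewrite divr_gt0 ?exprn_gt0 ?mulr_gt0.
  apply: (le_trans (H _ l0)); rewrite expr0n mulr0 add0r.
  by rewrite le_eqVlt; apply/orP; left; apply/eqP; field; rewrite !gt_eqF.
apply: (le_trans (H (b / h) _)); first exact: divr_gt0.
by rewrite le_eqVlt; apply/orP; left; apply/eqP; field; rewrite !gt_eqF.
Qed.

Lemma mgf_le G rad u : in_Gkd rad G -> mgf G u <= expR (eucl u * rad).
Proof.
move=> [[w0 w1] Gr]; rewrite -[leRHS]mul1r -w1 mulr_suml; apply: ler_sum => j _.
rewrite ler_wpM2l// ler_expR (le_trans (dot_le_eucl _ _))// ler_wpM2l ?Gr// eucl_ge0//.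
Qed.

(** With f = exp <u, x>, AM-GM on f (sqrt p - sqrt q)(sqrt p + sqrt q) gives f (p - q) <= la/2 (sqrt
    p - sqrt q)^2 + f^2 (p + q)/la. Integrating and optimising [la] yields the Hellinger distance
    times a bound on the integrals of f^2 p and f^2 q. *)
Lemma mgf_sub_le G G' rad u : 0 <= rad -> in_Gkd rad G -> in_Gkd rad G' ->
  mgf G u - mgf G' u <= 2 * expR (eucl u ^+ 2 + eucl u * rad) * hellinger G G'.
Proof.
move=> rad0 GG GG'; have [Gd _] := GG; have [Gd' _] := GG'.
have tI := tonelli_functional_iint R d.
set s := eucl u; set h := hellinger G G'.
have s0 : 0 <= s by exact: eucl_ge0.
have h0 : 0 <= h by exact: hellinger_ge0.
have e1 : 1 <= expR (dot u u / 2) by rewrite -expR0 ler_expR divr_ge0 ?dot_ge0.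
have [D0|D0] := leP (mgf G u - mgf G' u) 0.
  by apply: (le_trans D0); rewrite !mulr_ge0 ?expR_ge0.
apply: (@le_trans _ _ (expR (dot u u / 2) * (mgf G u - mgf G' u))).
  by rewrite ler_peMl// ltW.
apply: le_amgm_mul => //; first by rewrite mulr_gt0 ?expR_gt0.
move=> la la0.
(* The square of the test function is the test function at 2u, so its integrals are again moment
   generating functions. *)
pose u2 := tscale 2 u.
have exp2 x : expR (dot u2 x) = expR (dot u x) ^+ 2.
  by rewrite dot_tscalel -expRM_natl.
(* The term with q stays on the right, so that only nonnegative functions are integrated. *)
have pw x : expR (dot u x) * mixpdf G x <= expR (dot u x) * mixpdf G' x +
   ((la / 2) * sqrt_gap G G' x + (la^-1 * (expR (dot u2 x) * mixpdf G x) + la^-1 * (expR (dot u2 x) * mixpdf G' x))).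
  rewrite exp2 /sqrt_gap; set f := expR _.
  have f0 : 0 <= f by exact: expR_ge0.
  have p0 := mixpdf_ge0 x Gd; have q0 := mixpdf_ge0 x Gd'.
  rewrite -(sqr_sqrtr p0) -(sqr_sqrtr q0).
  set a := Num.sqrt (mixpdf G x); set b := Num.sqrt (mixpdf G' x).
  rewrite !sqrtr_sqr !ger0_norm ?sqrtr_ge0//.
  have a0 : 0 <= a by exact: sqrtr_ge0.
  have b0 : 0 <= b by exact: sqrtr_ge0.
  rewrite -subr_ge0.
  rewrite (_ : _ - _ = (2 * la)^-1 * ((la * (a - b) - f * (a + b)) ^+ 2 + f ^+ 2 * (a - b) ^+ 2)).
    apply: mulr_ge0; first by rewrite invr_ge0 mulr_ge0// ltW.
    by apply: addr_ge0; [exact: sqr_ge0|apply: mulr_ge0; exact: sqr_ge0].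
  by field; rewrite gt_eqF.
have me G0 v : measurable_fun setT (fun x : pt d => (expR (dot v x) * mixpdf G0 x)%:E).
  apply/measurable_EFinP; apply: measurable_funM; first exact: measurable_expR_dot.
  exact: measurable_mixpdf.
have e0 G0 v : is_mixdist G0 -> forall x, (0 <= (expR (dot v x) * mixpdf G0 x)%:E)%E.
  by move=> H x; rewrite lee_fin mulr_ge0 ?expR_ge0 ?mixpdf_ge0.
have q0 x : (0 <= (sqrt_gap G G' x)%:E)%E by rewrite lee_fin sqr_ge0.
have mq := measurable_sqrt_gap Gd Gd'.
have msc c (f : pt d -> \bar R) : measurable_fun setT f ->
    measurable_fun setT (fun x => c%:E * f x)%E.
  by move=> mf; apply: emeasurable_funM => //; exact: measurable_cst.
have l2 : 0 <= la / 2 by rewrite divr_ge0// ltW.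
have li : 0 <= la^-1 by rewrite invr_ge0 ltW.
have := tf_le tI (e0 G u Gd) (g := fun x => ((expR (dot u x) * mixpdf G' x)%:E +
   ((la / 2)%:E * (sqrt_gap G G' x)%:E + (la^-1%:E * (expR (dot u2 x) * mixpdf G x)%:E
    + la^-1%:E * (expR (dot u2 x) * mixpdf G' x)%:E)))%E).
have sc0 c (f : pt d -> \bar R) : 0 <= c -> (forall x, 0 <= f x)%E -> forall x, (0 <= c%:E * f x)%E.
  by move=> c0 f0 x; rewrite mule_ge0.
have g1 := sc0 _ _ l2 q0.
have g2 := sc0 _ _ li (e0 G u2 Gd).
have g3 := sc0 _ _ li (e0 G' u2 Gd').
have m1 := msc (la / 2) _ mq.
have m2 := msc la^-1 _ (me G u2).
have m3 := msc la^-1 _ (me G' u2).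
have g23 x := adde_ge0 (g2 x) (g3 x).
have g123 x := adde_ge0 (g1 x) (g23 x).
have m23 := emeasurable_funD m2 m3.
have m123 := emeasurable_funD m1 m23.
rewrite (tf_add tI (me G' u) m123 (e0 G' u Gd') g123).
rewrite (tf_add tI m1 m23 g1 g23) (tf_add tI m2 m3 g2 g3).
rewrite (tf_scale tI l2 mq q0) (tf_scale tI li (me G u2) (e0 G u2 Gd)).
rewrite (tf_scale tI li (me G' u2) (e0 G' u2 Gd')).
rewrite -sqr_hellinger// !iint_mgf// => /(_ pw).
rewrite -!EFinM -!EFinD lee_fin -/h => key.
have mu2 G0 : in_Gkd rad G0 -> expR (dot u2 u2 / 2) * mgf G0 u2 <= expR (s ^+ 2 + s * rad) ^+ 2.
  move=> GG0; apply: (le_trans (ler_wpM2l (expR_ge0 _) (mgf_le u2 GG0))).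
  rewrite -expRD -expRM_natl ler_expR.
  have -> : eucl u2 = 2 * s.
    rewrite euclE !(dot_tscalel, dot_tscaler) mulrA sqrtrM; last by rewrite mulr_ge0.
    by rewrite -euclE -expr2 sqrtr_sqr ger0_norm.
  by rewrite !(dot_tscalel, dot_tscaler) -sqr_eucl -/s; lra.
have k1 := mu2 _ GG; have k2 := mu2 _ GG'.
rewrite mulrBr lerBlDl; apply: (le_trans key).
rewrite lerD2l lerD2l -mulrDr exprMn.
rewrite (_ : 2 ^+ 2 * _ / (2 * la) = la^-1 * (expR (s ^+ 2 + s * rad) ^+ 2 + expR (s ^+ 2 + s * rad) ^+ 2)).
  by rewrite ler_wpM2l// lerD.
by field; rewrite gt_eqF.
Qed.

Lemma normr_mgf_sub_le G G' rad u : 0 <= rad -> in_Gkd rad G -> in_Gkd rad G' ->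
  `|mgf G u - mgf G' u| <= 2 * expR (eucl u ^+ 2 + eucl u * rad) * hellinger G G'.
Proof.
move=> r0 GG GG'; rewrite ler_norml mgf_sub_le// andbT lerNl opprB hellingerC.
exact: mgf_sub_le.
Qed.

End hellinger.

(** * From the Hellinger to the Wasserstein distance *)

Section wasserstein.
Variable R : realType.
Local Notation pt d := (d.-tuple R).

Definition is_coupling k d (G G' : mix R k d) (pi : 'I_k -> 'I_k -> R) :=
  [/\ forall i j, 0 <= pi i j,
      forall i, \sum_(j < k) pi i j = mw G i &
      forall j, \sum_(i < k) pi i j = mw G' j].

Definition cost k d (G G' : mix R k d) (pi : 'I_k -> 'I_k -> R) :=
  \sum_(i < k) \sum_(j < k) pi i j * eucl (tsub (ma G i) (ma G' j)).

Lemma cost_ge0 k d (G G' : mix R k d) pi : is_coupling G G' pi -> 0 <= cost G G' pi.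
Proof.
by case=> pi0 _ _; apply: sumr_ge0 => i _; apply: sumr_ge0 => j _; rewrite mulr_ge0// eucl_ge0.
Qed.

Lemma W1_ge0 k d (G G' : mix R k d) : 0 <= W1 G G'.
Proof.
have [[c Ac]|A0] := pselect (exists c, [set c : R | exists pi : 'I_k -> 'I_k -> R,
         [/\ forall i j, 0 <= pi i j,
             forall i, \sum_(j < k) pi i j = mw G i,
             forall j, \sum_(i < k) pi i j = mw G' j &
             c = \sum_(i < k) \sum_(j < k) pi i j * eucl (tsub (ma G i) (ma G' j))]] c).
  apply: lb_le_inf; first by exists c.
  by move=> _ [pi [p0 p1 p2 ->]]; apply: (@cost_ge0 _ _ G G' pi).
(* Without any coupling the infimum is over the empty set and takes its default value 0. *)
rewrite /W1; set A := [set c | _]; suff -> : A = set0 by rewrite inf0.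
by rewrite -subset0 => c Ac; apply: A0; exists c.
Qed.

Lemma W1_le_cost k d (G G' : mix R k d) pi : is_coupling G G' pi -> W1 G G' <= cost G G' pi.
Proof.
move=> [p0 p1 p2]; apply: ge_inf; last by exists pi; split.
by exists 0 => _ [pi' [p0' p1' p2' ->]]; apply: (@cost_ge0 _ _ G G' pi').
Qed.

(** For t <= s, exp s - exp t = exp t (exp (s - t) - 1) >= exp (- r) (s - t). *)
Lemma expR_sub_ge (s t r : R) : - r <= s -> - r <= t -> `|s - t| <= expR r * `|expR s - expR t|.
Proof.
wlog st : s t / t <= s.
  move=> H rs rt; have [|/ltW] := leP t s; first by move=> ts; exact: H.
  by move=> ts; rewrite distrC (distrC (expR s)); exact: H.
move=> rs rt; rewrite !ger0_norm ?subr_ge0 ?ler_expR//.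
have -> : expR s - expR t = expR t * (expR (s - t) - 1).
  by rewrite mulrBr -expRD mulr1 (_ : t + (s - t) = s)//; ring.
have h := expR_ge1Dx (s - t).
rewrite mulrA -expRD -[leLHS]mul1r ler_pM// ?subr_ge0//; last by lra.
by rewrite -expR0 ler_expR; lra.
Qed.

(** The right side is (y - 1/y)^2 with y = exp(t/2), and y - 1/y >= t/2 when t >= 0. *)
Lemma expR_cosh_ge (t : R) : t ^+ 2 / 4 <= expR t + expR (- t) - 2.
Proof.
wlog t0 : t / 0 <= t.
  move=> H; have [|/ltW t0] := leP 0 t; first exact: H.
  have := H (- t); rewrite opprK sqrrN oppr_ge0 => /(_ t0) /le_trans; apply; lra.
set y := expR (t / 2).
have y1 : 1 + t / 2 <= y by exact: expR_ge1Dx.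
have y0 : 0 < y by exact: expR_gt0.
have eE : expR t = y ^+ 2 by rewrite -expRM_natl; congr expR; field.
rewrite expRN eE.
have yv : y * y^-1 = 1 by rewrite divff ?gt_eqF.
have v0 : 0 < y^-1 by rewrite invr_gt0.
have -> : y ^+ 2 + (y ^+ 2)^-1 - 2 = (y - y^-1) ^+ 2 by rewrite -exprVn; ring: yv.
have v1 : y^-1 <= 1 by nra.
have : t / 2 <= y - y^-1 by lra.
nra.
Qed.

(** The product of the constants met in the next proof: 2 exp(rad) from [K], 2 from [n], 2(1 +
    exp(rad)) from the interpolation and [E] from the moments. *)
Definition W1const (rad : R) :=
  16 * expR rad * (1 + expR rad) * expR (4 * (1 + rad)).

Lemma coupling_le_hellinger k d (G G' : mix R k d) rad e : (2 <= k)%N -> (d <= k)%N ->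
  0 <= rad -> in_Gkd rad G -> in_Gkd rad G' -> 0 < e ->
  exists pi, is_coupling G G' pi /\
    cost G G' pi <= W1const rad * k%:R ^+ 5 * (hellinger G G') `^ ((2 * k - 1)%:R^-1) + e.
Proof.
move=> k2 dk rad0 GG GG' e0; have [[w0 w1] Gr] := GG; have [[w0' w1'] Gr'] := GG'.
have k0 : 0 < k%:R :> R by rewrite ltr0n (leq_trans _ k2).
set h := hellinger G G'; have h0 : 0 <= h by exact: hellinger_ge0.
set q := _%:R^-1; set n := (2 * k)%N.
pose v (p : 'I_k * 'I_k) l := tnth (ma G p.1) l - tnth (ma G' p.2) l.
have [th [th01 thP]] := exists_direction v.
have cardV : #|{: 'I_k * 'I_k}|%:R = k%:R ^+ 2 :> R by rewrite card_prod !card_ord natrM expr2.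
(* The division by k gives |u|^2 <= d/k^2 <= 1/k. *)
pose u : pt d := [tuple th l / k%:R | l < d].
have uu : dot u u <= k%:R^-1.
  apply: (@le_trans _ _ (\sum_(l < d) k%:R^-1 ^+ 2)).
    apply: ler_sum => l _; rewrite !tnth_mktuple -expr2 exprMn ler_piMl ?sqr_ge0//.
    by have /andP[a b] := th01 l; rewrite expr_le1.
  rewrite sumr_const card_ord -[leLHS]mulr_natl expr2 mulrA.
  apply: ler_piMl; first by rewrite invr_ge0 ltW.
  by rewrite ler_pdivrMr// mul1r ler_nat.
have uE : eucl u <= 1.
  apply: eucl_le => //; rewrite expr1n (le_trans uu)// invf_le1// ler1n.
  exact: leq_trans k2.
have dotu (x : pt d) : eucl x <= rad -> `|dot u x| <= rad.
  move=> xr; rewrite (le_trans (normr_dot_le _ _))// (le_trans _ xr)// ler_piMl ?eucl_ge0//.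
pose y i := expR (dot u (ma G i)); pose y' j := expR (dot u (ma G' j)).
have yB i : `|y i| <= expR rad.
  rewrite ger0_norm ?expR_ge0// ler_expR.
  by rewrite (le_trans (ler_norm _))// dotu.
have yB' i : `|y' i| <= expR rad.
  rewrite ger0_norm ?expR_ge0// ler_expR.
  by rewrite (le_trans (ler_norm _))// dotu.
(* The moment of order l of the points exp <u, a> is the moment generating function at l u. For l <
   2k one has |l u|^2 <= 4k, hence also |l u| <= 4k, which gives the exponent 4k(1 + rad). *)
set de := 2 * expR (k%:R * (4 * (1 + rad))) * h.
have mgfE (H : mix R k d) l : \sum_i mw H i * expR (dot u (ma H i)) ^+ l = mgf H (tscale l%:R u).
  by apply: eq_bigr => i _; rewrite dot_tscalel expRM_natl.
have mom l : (l < n)%N -> `|\sum_i mw G i * y i ^+ l - \sum_j mw G' j * y' j ^+ l| <= de.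
  move=> ln; rewrite /y /y' !mgfE.
  apply: (le_trans (normr_mgf_sub_le _ rad0 GG GG')).
  rewrite /de ler_wpM2r// ler_wpM2l// ler_expR.
  set s := eucl _; have s0 : 0 <= s by exact: eucl_ge0.
  have l2k : l%:R <= 2 * k%:R :> R by rewrite -natrM ler_nat ltnW.
  have l0 : 0 <= l%:R :> R by [].
  have s2 : s ^+ 2 <= 4 * k%:R.
    rewrite sqr_eucl dot_tscalel dot_tscaler mulrA -expr2.
    apply: (@le_trans _ _ ((2 * k%:R) ^+ 2 * k%:R^-1)).
      apply: ler_pM; rewrite ?sqr_ge0 ?dot_ge0//.
      by rewrite ler_pXn2r ?nnegrE ?mulr_ge0// ltW.
    by rewrite le_eqVlt; apply/orP; left; apply/eqP; field; rewrite gt_eqF.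
  have k1 : 1 <= k%:R :> R by rewrite ler1n (leq_trans _ k2).
  have s4 : s <= 4 * k%:R by nra.
  by nra.
set E := 2 * expR (4 * (1 + rad)).
have E0 : 0 < E by rewrite mulr_gt0 ?expR_gt0.
have n1 : n.-1 = (2 * k - 1)%N by rewrite subn1.
have n10 : (0 < n.-1)%N by rewrite n1 subn_gt0 (leq_trans k2)// leq_pmull.
have kn : (k <= n.-1)%N by rewrite n1 mul2n -addnn -addnBA ?leq_addr// (leq_trans _ k2).
(* As k <= 2k - 1, the factor exponential in k is absorbed into a power of [E] that the (2k-1)-th
   root removes. *)
have Ede : de <= E ^+ n.-1 * h.
  rewrite /de ler_wpM2r// /E exprMn; apply: ler_pM; rewrite ?expR_ge0//.
    by rewrite -[leLHS]expr1 ler_weXn2l// ler1n.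
  rewrite -expRM_natl ler_expR ler_wpM2r ?ler_nat//.
  by rewrite mulr_ge0// addr_ge0.
have hq : (h `^ q) ^+ n.-1 = h.
  rewrite -powR_mulrn ?powR_ge0// -powRrM /q -n1 mulVf ?powRr1// pnatr_eq0 -lt0n//.
(* Factors of [K]: 2k^2 from [exists_direction] for k^2 pairs, k from the scaling of [u], exp(rad)
   from inverting the exponential, and k from passing from coordinates to the norm. *)
pose K := 2 * k%:R ^+ 4 * expR rad.
have K0 : 0 < K by rewrite !mulr_gt0 ?exprn_gt0 ?expR_gt0.
have n0 : 0 < n%:R :> R by rewrite ltr0n (leq_trans n10)// leq_pred.
(* The second summand keeps [x] positive when the Hellinger distance is zero; it adds exactly [e] to
   the final bound. *)
pose x := 2 * (1 + expR rad) * (E * h `^ q) + e / (K * n%:R).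
have B0 : 0 <= 2 * (1 + expR rad) by rewrite mulr_ge0// addr_ge0// expR_ge0.
have P0 : 0 <= 2 * (1 + expR rad) * (E * h `^ q).
  by apply: mulr_ge0 => //; apply: mulr_ge0; [exact: ltW|exact: powR_ge0].
have x0 : 0 < x.
  by apply: ltr_wpDl => //; rewrite divr_gt0// mulr_gt0.
have hx : (2 * (1 + expR rad)) ^+ n.-1 * de <= x ^+ n.-1.
  apply: (@le_trans _ _ ((2 * (1 + expR rad) * (E * h `^ q)) ^+ n.-1)).
    rewrite (exprMn _ (2 * (1 + expR rad)) (E * h `^ q)) (exprMn _ E) hq.
    by apply: ler_wpM2l => //; exact: exprn_ge0.
  apply: lerXn2r; rewrite ?nnegrE// ?(ltW x0)//.
  by rewrite lerDl ltW// divr_gt0// mulr_gt0.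
have card2 : (#|'I_k| + #|'I_k|)%N = n by rewrite !card_ord addnn -mul2n.
have n1' : (1 < n)%N by rewrite (leq_trans k2)// leq_pmull.
have [pi [p0 p1 p2 p3]] :=
  moments_coupling card2 n1' w0 w0' w1 w1' yB yB' mom x0 hx.
exists pi; split; first by split.
have vK i j : eucl (tsub (ma G i) (ma G' j)) <= K * `|y i - y' j|.
  have E1 : `|\sum_l th l * v (i, j) l| = k%:R * `|dot u (ma G i) - dot u (ma G' j)|.
    rewrite -[k%:R in RHS]ger0_norm ?ltW// -normrM; congr (`|_|).
    rewrite -dot_tsubr /dot mulr_sumr; apply: eq_bigr => l _.
    by rewrite !tnth_mktuple /v/=; field; rewrite gt_eqF.
  have E2 : `|dot u (ma G i) - dot u (ma G' j)| <= expR rad * `|y i - y' j|.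
    have low z : eucl z <= rad -> - rad <= dot u z by move=> /dotu; rewrite ler_norml => /andP[].
    by apply: expR_sub_ge; apply: low.
  set D := `|y i - y' j| in E2 *.
  have D0 : 0 <= D by exact: normr_ge0.
  pose M := 2 * k%:R ^+ 3 * (expR rad * D).
  have M0 : 0 <= M by rewrite !mulr_ge0 ?exprn_ge0 ?expR_ge0// ltW.
  have vM l : `|v (i, j) l| <= M.
    apply: (le_trans (thP (i, j) l)); rewrite cardV E1 /M.
    rewrite (_ : 2 * k%:R ^+ 3 * _ = 2 * k%:R ^+ 2 * (k%:R * (expR rad * D))); last by ring.
    by rewrite !ler_wpM2l// ?mulr_ge0 ?exprn_ge0// ltW.
  rewrite (_ : K * D = k%:R * M); last by rewrite /K /M; ring.
  apply: eucl_le; first by rewrite mulr_ge0// ltW.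
  apply: (@le_trans _ _ (\sum_(l < d) M ^+ 2)).
    apply: ler_sum => l _; rewrite -expr2 tnth_mktuple -[leLHS]real_normK ?num_real//.
    by rewrite ler_pXn2r ?nnegrE//; exact: (vM l).
  rewrite sumr_const card_ord -[leLHS]mulr_natl (exprMn _ k%:R M) ler_wpM2r ?sqr_ge0//.
  apply: (@le_trans _ _ k%:R); first by rewrite ler_nat.
  by rewrite expr2; apply: ler_peMl; [exact: ltW|rewrite ler1n (leq_trans _ k2)].
apply: (@le_trans _ _ (K * (n%:R * x))).
  apply: (le_trans _ (ler_wpM2l (ltW K0) p3)).
  rewrite mulr_sumr; apply: ler_sum => i _; rewrite mulr_sumr; apply: ler_sum => j _.
  by rewrite mulrCA ler_wpM2l.
rewrite /x /W1const /E /K /n natrM le_eqVlt; apply/orP; left; apply/eqP.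
by field; rewrite !gt_eqF ?expR_gt0.
Qed.

End wasserstein.

(** * Residuals of the true atoms orthogonal to the estimated ones *)

Section residual.
Variable R : realType.
Local Notation pt d := (d.-tuple R).

(** Two directions with bound 2 exp(1 + rad) each, times 4 from [expR_cosh_ge]. *)
Definition resid_const (rad : R) := 16 * expR (1 + rad).

Lemma weighted_residual_le k d (G Gh : mix R k d) rad j (u : pt d) :
  0 <= rad -> in_Gkd rad G -> in_Gkd rad Gh ->
  (forall i, dot u (ma Gh i) = 0) -> dot u (ma G j) = dot u u ->
  mw G j * dot u u <= resid_const rad * hellinger Gh G.
Proof.
move=> r0 GG GGh uGh uG; have [[w0 w1] _] := GG; have [[wh0 wh1] _] := GGh.
have [u0|u0] := eqVneq (dot u u) 0.
  by rewrite u0 mulr0 !mulr_ge0 ?expR_ge0// hellinger_ge0.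
set s := eucl u.
have s0 : 0 < s by rewrite /s euclE sqrtr_gt0 lt_def u0 dot_ge0.
have ss : s ^+ 2 = dot u u by exact: sqr_eucl.
pose e (c : R) : pt d := tscale (c / s) u.
have eucl1 c : c ^+ 2 = 1 -> eucl (e c) = 1.
  move=> c2; rewrite euclE dot_tscalel dot_tscaler mulrA -expr2 exprMn c2 mul1r exprVn ss.
  by rewrite mulVf// sqrtr1.
have mh c : mgf Gh (e c) = 1.
  rewrite -[RHS]wh1; apply: eq_bigr => i _; rewrite dot_tscalel uGh mulr0 expR0 mulr1//.
have bound c : c ^+ 2 = 1 -> mgf G (e c) - 1 <= 2 * expR (1 + rad) * hellinger Gh G.
  move=> c2; rewrite -[X in _ - X](mh c) hellingerC.
  have := mgf_sub_le (e c) r0 GG GGh; rewrite (eucl1 _ c2) expr1n mul1r; exact.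
have b1 := bound 1 (expr1n _ _).
have b2 := bound (-1) (etrans (sqrrN _) (expr1n _ _)).
(* Orthogonality made [mgf Gh] equal to 1 in both directions. The sum over the two is an average of
   terms exp t + exp(-t) - 2 >= 0, of which only the one of atom [j] is kept. *)
have sumb : mw G j * (s ^+ 2 / 4) <= (mgf G (e 1) - 1) + (mgf G (e (-1)) - 1).
  have -> : (mgf G (e 1) - 1) + (mgf G (e (-1)) - 1) =
      \sum_i mw G i * (expR (dot (e 1) (ma G i)) + expR (- dot (e 1) (ma G i)) - 2).
    rewrite [RHS](eq_bigr (fun i => mw G i * expR (dot (e 1) (ma G i)) +
        mw G i * expR (dot (e (-1)) (ma G i)) - mw G i * 2)).
      by rewrite sumrB big_split/= -mulr_suml w1 /mgf; ring.
    by move=> i _; rewrite !dot_tscalel !mulNr; ring.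
  rewrite (bigD1 j)//= -[leLHS]addr0; apply: lerD.
    rewrite ler_wpM2l//.
    have -> : s ^+ 2 = dot (e 1) (ma G j) ^+ 2.
      by rewrite dot_tscalel uG -ss; field; rewrite gt_eqF.
    exact: expR_cosh_ge.
  apply: sumr_ge0 => i _; rewrite mulr_ge0//.
  by apply: le_trans (expR_cosh_ge _); rewrite divr_ge0 ?sqr_ge0.
rewrite -ss /resid_const.
have -> : mw G j * s ^+ 2 = 4 * (mw G j * (s ^+ 2 / 4)) by field.
lra.
Qed.

End residual.

(** * Risk of the two-stage estimator *)

Section samples.
Variable R : realType.
Local Notation pt d := (d.-tuple R).

Lemma tonelli_functional_weight {d} {T : measurableType d} (I : (T -> \bar R) -> \bar R) (w : T -> R) :
  tonelli_functional I -> measurable_fun setT w -> (forall x, 0 <= w x) ->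
  tonelli_functional (fun f => I (fun x => (w x)%:E * f x)%E).
Proof.
move=> tI mw w0.
have mE (f : T -> \bar R) : measurable_fun setT f ->
    measurable_fun setT (fun x => (w x)%:E * f x)%E.
  by move=> mf; apply: emeasurable_funM => //; exact/measurable_EFinP.
have E0 (f : T -> \bar R) : (forall x, 0 <= f x)%E -> forall x, (0 <= (w x)%:E * f x)%E.
  by move=> f0 x; rewrite mule_ge0// lee_fin.
split.
- move=> f g f0 fg; apply: (tf_le tI); first exact: E0.
  by move=> x; rewrite lee_wpmul2l// lee_fin.
- move=> f g mf mg f0 g0; rewrite -(tf_add tI); [|exact: mE|exact: mE|exact: E0|exact: E0].
  by congr I; apply/funext => x; rewrite ge0_muleDr.
- move=> c f c0 mf f0; rewrite -(tf_scale tI)//; [|exact: mE|exact: E0].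
  by congr I; apply/funext => x; rewrite muleCA.
- move=> d' A f mf f0.
  apply: (tf_meas tI (f := fun a x => ((w x)%:E * f a x)%E)).
    apply: emeasurable_funM => //; apply/measurable_EFinP.
    exact: (measurableT_comp mw).
  by move=> a x; rewrite mule_ge0// lee_fin.
Qed.

(** A concave power lies below its tangent at [t]. After dividing by t^al this is z^al <= al z + 1 -
    al with z = h/t. *)
Lemma powR_le_tangent (h t al : R) : 0 <= h -> 0 < t -> 0 < al -> al <= 1 ->
  h `^ al <= al * t `^ (al - 1) * h + (1 - al) * t `^ al.
Proof.
move=> h0 t0 al0 al1.
have tE : t `^ (al - 1) * t = t `^ al.
  by rewrite -[X in _ * X]powRr1 ?ltW// -powRD ?subrK// gt_eqF ?implybT.
have := h0; rewrite le_eqVlt => /orP[/eqP <-|{}h0].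
  by rewrite powR0 ?gt_eqF// mulr0 add0r mulr_ge0 ?powR_ge0// subr_ge0.
have -> : al * t `^ (al - 1) * h = al * t `^ al * (h / t).
  by rewrite -tE; field; rewrite gt_eqF.
have -> : h `^ al = t `^ al * (h / t) `^ al.
  by rewrite -powRM ?ltW ?divr_gt0// mulrC divfK// gt_eqF.
rewrite (_ : _ + _ = t `^ al * (al * (h / t) + (1 - al))); last by ring.
rewrite ler_wpM2l ?powR_ge0//.
have z0 : 0 < h / t by rewrite divr_gt0.
move: (h / t) z0 => z z0.
set s := ln z; have zE : z = expR s by rewrite lnK.
have -> : z `^ al = expR (al * s) by rewrite /powR gt_eqF.
have h1 : expR (al * s) * (1 + (1 - al) * s) <= z.
  rewrite zE (_ : expR s = expR (al * s) * expR ((1 - al) * s)).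
    by rewrite ler_wpM2l ?expR_ge0// expR_ge1Dx.
  by rewrite -expRD; congr expR; ring.
have h2 : expR (al * s) * (1 - al * s) <= 1.
  rewrite -[leRHS]expR0 (_ : expR 0 = expR (al * s) * expR (- (al * s))).
    by rewrite ler_wpM2l ?expR_ge0// expR_ge1Dx.
  by rewrite -expRD; congr expR; ring.
have al1' : 0 <= 1 - al by rewrite subr_ge0.
(* In the combination al h1 + (1 - al) h2 the terms linear in [s] cancel. *)
have := lerD (ler_wpM2l (ltW al0) h1) (ler_wpM2l al1' h2).
rewrite mulr1; apply: le_trans; rewrite le_eqVlt; apply/orP; left; apply/eqP; ring.
Qed.

(** Jensen's inequality, obtained by integrating the tangent at [b]. *)
Lemma tf_powR_le {d} {T : measurableType d} (I : (T -> \bar R) -> \bar R) (h : T -> R) (b al : R) :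
  tonelli_functional I -> I (fun=> 1%E) = 1%E -> measurable_fun setT h -> (forall x, 0 <= h x) ->
  0 < al -> al <= 1 -> 0 <= b -> (I (fun x => (h x)%:E) <= b%:E)%E ->
  (I (fun x => (h x `^ al)%:E) <= (b `^ al)%:E)%E.
Proof.
move=> tI I1 mh h0 al0 al1 b0 Ihb.
have key t : 0 < t -> b <= t -> (I (fun x => (h x `^ al)%:E) <= (t `^ al)%:E)%E.
  move=> t0 bt; pose c := al * t `^ (al - 1).
  have c0 : 0 <= c by rewrite mulr_ge0 ?powR_ge0// ltW.
  have e0 : 0 <= (1 - al) * t `^ al by rewrite mulr_ge0 ?powR_ge0// subr_ge0.
  have mhE : measurable_fun setT (fun x => (h x)%:E) by exact/measurable_EFinP.
  have hE0 x : (0 <= (h x)%:E)%E by rewrite lee_fin.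
  apply: (@le_trans _ _ (I (fun x => c%:E * (h x)%:E + ((1 - al) * t `^ al)%:E * 1)%E)).
    apply: (tf_le tI) => x; first by rewrite lee_fin powR_ge0.
    by rewrite mule1 -EFinM -EFinD lee_fin powR_le_tangent.
  rewrite (tf_add tI); last 4 first.
  - by apply: emeasurable_funM => //; exact: measurable_cst.
  - by apply: emeasurable_funM; exact: measurable_cst.
  - by move=> x; rewrite mule_ge0// lee_fin.
  - by move=> x; rewrite mule_ge0// lee_fin.
  rewrite (tf_scale tI)// (tf_scale tI)// I1 mule1.
  apply: (@le_trans _ _ (c%:E * t%:E + ((1 - al) * t `^ al)%:E)%E).
    rewrite leeD2r// lee_wpmul2l ?lee_fin//; apply: (le_trans Ihb); by rewrite lee_fin.
  rewrite -EFinM -EFinD lee_fin /c le_eqVlt; apply/orP; left; apply/eqP.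
  have -> : al * t `^ (al - 1) * t = al * t `^ al.
    by rewrite -mulrA -[X in _ * (_ * X)]powRr1 ?ltW// -powRD ?subrK// gt_eqF ?implybT.
  ring.
have [b1|b1] := ltP 0 b; first exact: key.
have -> : b = 0 by apply/eqP; rewrite eq_le b1.
(* For b = 0 there is no tangent at [b]; tangents at arbitrarily small positive points replace
   it. *)
rewrite powR0 ?gt_eqF//; apply/lee_addgt0Pr => e e0; rewrite add0e.
have := key (e `^ al^-1) (powR_gt0 _ e0) (le_trans b1 (powR_ge0 _ _)).
by rewrite -powRrM mulVf ?gt_eqF// powRr1// ltW.
Qed.

Variables k d : nat.
Implicit Types (G : mix R k d).

Definition prodpdf G n (xs : n.-tuple (pt d)) : R := \prod_(i < n) mixpdf G (tnth xs i).

(** Expectation over n independent observations. It accepts extended real integrands, as [expect]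
    does not, and is therefore a Tonelli functional. *)
Definition sexp G n (F : n.-tuple (pt d) -> \bar R) : \bar R :=
  sint (fun xs => (prodpdf G xs)%:E * F xs)%E.

Lemma prodpdf_ge0 G n (xs : n.-tuple (pt d)) : is_mixdist G -> 0 <= prodpdf G xs.
Proof. by move=> Gd; apply: prodr_ge0 => i _; exact: mixpdf_ge0. Qed.

Lemma measurable_prodpdf G n : measurable_fun setT (@prodpdf G n).
Proof. by apply: measurable_prod => i _; apply: measurable_mixpdf; exact: measurable_tnth. Qed.

Lemma tonelli_functional_sexp G n : is_mixdist G -> tonelli_functional (@sexp G n).
Proof.
move=> Gd; apply: tonelli_functional_weight; first exact: tonelli_functional_sint.
  exact: measurable_prodpdf.
by move=> x; exact: prodpdf_ge0.
Qed.

Lemma prodpdf_cons G n x (xs : n.-tuple (pt d)) :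
  prodpdf G (cons_tuple x xs) = mixpdf G x * prodpdf G xs.
Proof.
rewrite /prodpdf big_ord_recl; congr (_ * _).
by apply: eq_bigr => i _; rewrite tnthS.
Qed.

Lemma sexp_cons G n (F : n.+1.-tuple (pt d) -> \bar R) : is_mixdist G ->
  measurable_fun setT F -> (forall x, 0 <= F x)%E ->
  sexp G F = iint (fun x => (mixpdf G x)%:E * sexp G (fun xs => F (cons_tuple x xs)))%E.
Proof.
move=> Gd mF F0; rewrite {1}/sexp /=; congr iint; apply/funext => x.
rewrite -(tf_scale (tonelli_functional_sint R d n)).
- by congr sint; apply/funext => xs; rewrite prodpdf_cons EFinM muleA.
- exact: mixpdf_ge0.
- apply: emeasurable_funM; first by apply/measurable_EFinP; exact: measurable_prodpdf.
  by apply: measurableT_comp => //; exact: measurable_cons_pair.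
- by move=> xs; rewrite mule_ge0// lee_fin prodpdf_ge0.
Qed.

Lemma sexp1 G n : is_mixdist G -> sexp G (fun _ : n.-tuple (pt d) => 1%E) = 1%E.
Proof.
move=> Gd; elim: n => [|n IH]; first by rewrite /sexp /= /prodpdf big_ord0 mule1.
rewrite sexp_cons// IH -[RHS](iint_mixpdf Gd); congr iint; apply/funext => x.
by rewrite mule1.
Qed.

Lemma expectE G n (F : n.-tuple (pt d) -> R) : expect G F = sexp G (fun xs => (F xs)%:E).
Proof. by congr sint; apply/funext => xs; rewrite -EFinM mulrC. Qed.

Lemma sint_cat m n (F : (m + n).-tuple (pt d) -> \bar R) :
  sint F = sint (fun a : m.-tuple (pt d) => sint (fun b : n.-tuple (pt d) => F (cat_tuple a b))).
Proof.
elim: m F => [|m IH] F.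
  rewrite [RHS]/=; congr (@sint R d n _); apply/funext => b; congr F; exact: val_inj.
rewrite /= ; congr iint; apply/funext => x; rewrite IH; congr sint; apply/funext => a.
by congr sint; apply/funext => b; congr F; exact: val_inj.
Qed.

(** The second half of the sample is integrated first, with the first half frozen. [F] enters
    through monotonicity alone; the majorant [U] carries the measurability. *)
Lemma expect_cat_le G n (F : (n + n).-tuple (pt d) -> R)
    (U : n.-tuple (pt d) -> n.-tuple (pt d) -> R) (Q : n.-tuple (pt d) -> R) : is_mixdist G ->
  (forall xs, 0 <= F xs) -> (forall a b, F (cat_tuple a b) <= U a b) ->
  (forall a, measurable_fun setT (U a)) ->
  (forall a, sexp G (fun b => (U a b)%:E) <= (Q a)%:E)%E ->
  (expect G F <= sexp G (fun a => (Q a)%:E))%E.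
Proof.
move=> Gd F0 FU mU UQ; rewrite expectE /sexp sint_cat.
have p0 m (a : m.-tuple (pt d)) := prodpdf_ge0 a Gd.
have pcat (a b : n.-tuple (pt d)) : prodpdf G (cat_tuple a b) = prodpdf G a * prodpdf G b.
  rewrite /prodpdf big_split_ord; congr (_ * _); apply: eq_bigr => i _.
    by rewrite tnth_lshift.
  by rewrite tnth_rshift.
have U0 a b : 0 <= U a b by exact: le_trans (FU a b).
apply: (tf_le (tonelli_functional_sint R d n)) => a.
  apply: (tf_ge0 (tonelli_functional_sint R d n)) => b.
  by rewrite mule_ge0// lee_fin.
apply: (@le_trans _ _ ((prodpdf G a)%:E * sexp G (fun b => (U a b)%:E))%E); last first.
  by rewrite lee_wpmul2l// lee_fin.
rewrite -(tf_scale (tonelli_functional_sint R d n))//; last 2 first.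
- apply: emeasurable_funM; apply/measurable_EFinP => //; exact: measurable_prodpdf.
- by move=> b; rewrite mule_ge0// lee_fin.
apply: (tf_le (tonelli_functional_sint R d n)) => b.
  by rewrite mule_ge0// lee_fin.
rewrite pcat EFinM -muleA; apply: lee_wpmul2l; first by rewrite lee_fin.
by apply: lee_wpmul2l; rewrite lee_fin.
Qed.

End samples.

(** * Projected samples and the loss of the two-stage estimator *)

Section projected_samples.
Variable R : realType.
Local Notation pt d := (d.-tuple R).

Lemma iint_mixpdf_mul k d (G : mix R k d) (f : pt d -> \bar R) : is_mixdist G ->
  measurable_fun setT f -> (forall x, 0 <= f x)%E ->
  iint (fun x => (mixpdf G x)%:E * f x)%E =
  (\sum_(j < k) (mw G j)%:E * iint (fun x => f x * (phid (tsub x (ma G j)))%:E))%E.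
Proof.
move=> [w0 w1] mf f0; have tI := tonelli_functional_iint R d.
have mp j : measurable_fun setT (fun x : pt d => f x * (phid (tsub x (ma G j)))%:E)%E.
  apply: emeasurable_funM => //; apply/measurable_EFinP.
  by apply: measurable_phid; exact: measurable_tsub.
have p0 j x : (0 <= f x * (phid (tsub x (ma G j)))%:E)%E by rewrite mule_ge0// lee_fin phid_ge0.
under [RHS]eq_bigr do rewrite -(tf_scale tI)//.
rewrite -(tf_sum tI); last 2 first.
- by move=> j; apply: emeasurable_funM => //; exact: measurable_cst.
- by move=> j x; rewrite mule_ge0// lee_fin.
congr iint; apply/funext => x; rewrite /mixpdf -sumEFin ge0_sume_distrl.
  by apply: eq_bigr => j _; rewrite EFinM -muleA [in RHS](muleC (f x)).
by move=> j _; rewrite lee_fin mulr_ge0// phid_ge0.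
Qed.

Definition qrmix k e (V : 'I_k -> pt (k + e)) (G : mix R k (k + e)) : mix R k k :=
  Mix (mw G) (fun j => qrproj V (ma G j)).

(** Cauchy-Schwarz on |Px|^2 = <x, lift (Px)>, the lift being an isometry. Projected mixtures thus
    keep the same radius. *)
Lemma eucl_qrproj k e (V : 'I_k -> pt (k + e)) x : eucl (qrproj V x) <= eucl x.
Proof.
have [p0|p0] := eqVneq (eucl (qrproj V x)) 0; first by rewrite p0 eucl_ge0.
have pos : 0 < eucl (qrproj V x) by rewrite lt_def p0 eucl_ge0.
rewrite -(ler_pM2r pos) -expr2 sqr_eucl dot_qrproj.
apply: (le_trans (dot_le_eucl _ _)).
by rewrite [eucl (qrlift _ _)]euclE dot_qrlift -euclE.
Qed.

Lemma in_Gkd_qrmix k e (V : 'I_k -> pt (k + e)) G rad : in_Gkd rad G -> in_Gkd rad (qrmix V G).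
Proof. by move=> [Gd Gr]; split => // j; apply: (le_trans (eucl_qrproj _ _)). Qed.

(** Projected observations are independent with the projected mixture as law: observations are
    peeled off one by one and [iint_qrproj] is applied to each component. *)
Lemma sexp_qrproj k e (V : 'I_k -> pt (k + e)) (G : mix R k (k + e)) n
    (F : n.-tuple (pt k) -> \bar R) : is_mixdist G ->
  measurable_fun setT F -> (forall x, 0 <= F x)%E ->
  sexp G (fun xs => F (map_tuple (qrproj V) xs)) = sexp (qrmix V G) F.
Proof.
move=> Gd; have Pd : is_mixdist (qrmix V G) by [].
have mproj : measurable_fun setT (fun x : pt (k + e) => qrproj V x).
  by apply: (measurable_qrproj (V := fun=> V)).
elim: n F => [|n IH] F mF F0.
  rewrite /sexp /= /prodpdf !big_ord0; congr (_ * F _)%E; exact: val_inj.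
have mmap : measurable_fun setT (fun xs : n.+1.-tuple (pt (k + e)) => map_tuple (qrproj V) xs).
  apply/measurable_fun_tnthP => i.
  rewrite (_ : _ \o _ = fun xs => qrproj V (tnth xs i)).
    by apply: (measurable_qrproj (V := fun=> V)) => //; exact: measurable_tnth.
  by apply/funext => xs /=; rewrite tnth_map.
rewrite sexp_cons//; last exact: measurableT_comp mmap.
rewrite sexp_cons//.
pose Phi (y : pt k) := sexp (qrmix V G) (fun ys => F (cons_tuple y ys)).
have mF2 : measurable_fun setT (fun p : pt k * n.-tuple (pt k) => F (cons_tuple p.1 p.2)).
  by apply: measurableT_comp => //; exact: measurable_cons_pair.
have mPhi : measurable_fun setT Phi.
  exact: (tf_meas (tonelli_functional_sexp n Pd) (f := fun y ys => F (cons_tuple y ys))).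
have Phi0 y : (0 <= Phi y)%E by apply: (tf_ge0 (tonelli_functional_sexp n Pd)).
transitivity (iint (fun x => (mixpdf G x)%:E * Phi (qrproj V x)))%E.
  congr iint; apply/funext => x; congr (_ * _)%E.
  rewrite /Phi -(IH (fun ys => F (cons_tuple (qrproj V x) ys)))//.
    by congr sexp; apply/funext => xs; congr F; exact: val_inj.
  by apply: measurableT_comp => //; exact: measurable_cons_pair.
rewrite iint_mixpdf_mul//; last exact: measurableT_comp mPhi mproj.
rewrite [RHS](iint_mixpdf_mul Pd mPhi Phi0).
by apply: eq_bigr => j _; congr (_ * _)%E; exact: iint_qrproj.
Qed.

Lemma measurable_hellinger k d n (est : n.-tuple (pt d) -> mix R k d) (G : mix R k d) :
  measurable_est est -> (forall xs, is_mixdist (est xs)) -> is_mixdist G ->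
  measurable_fun setT (fun xs => hellinger (est xs) G).
Proof.
move=> [mw_ ma_] ed Gd; rewrite /hellinger.
have tI := tonelli_functional_iint R d.
apply: measurable_sqrt_comp.
  by move=> xs; apply: fine_ge0; apply: (tf_ge0 tI) => x; rewrite lee_fin sqr_ge0.
apply: (measurableT_comp (f := fine)) => //.
apply: (tf_meas tI (f := fun xs x => (sqrt_gap (est xs) G x)%:E)).
  apply/measurable_EFinP; apply: measurable_funX; apply: measurable_funB.
    apply: (@measurable_sqrt_comp _ _ _ (fun p => mixpdf (est p.1) p.2)).
      by move=> p; exact: mixpdf_ge0.
    apply: measurable_sum => j; apply: measurable_funM.
      exact: (measurableT_comp (mw_ j)).
    apply: measurable_phid; apply: measurable_tsub => //.
    apply/measurable_fun_tnthP => i; exact: (measurableT_comp (ma_ j i)).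
  apply: (@measurable_sqrt_comp _ _ _ (fun p => mixpdf G p.2)).
    by move=> p; exact: mixpdf_ge0.
  exact: measurable_mixpdf.
by move=> xs x; rewrite lee_fin sqr_ge0.
Qed.

(* Density estimation on the projected second sample, lifted back to the span
   of the atoms estimated from the first one. *)
Definition two_stage k e n (est1 : n.-tuple (pt (k + e)) -> mix R k (k + e))
    (est2 : n.-tuple (pt k) -> mix R k k) (a b : n.-tuple (pt (k + e))) : mix R k (k + e) :=
  let V := ma (est1 a) in
  let G2 := est2 (map_tuple (qrproj V) b) in
  Mix (mw G2) (fun j => qrlift V (ma G2 j)).

(** Projection and lift keep the weights, so a coupling of the projected problem also couples the
    lifted estimate with [G]. Each path goes through the lift of the projected true atom: the first
    leg is isometric to the projected one, the second is the residual, charged with the weight of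
    the true atom. *)
Lemma W1_two_stage_le k e n (est1 : n.-tuple (pt (k + e)) -> mix R k (k + e))
    (est2 : n.-tuple (pt k) -> mix R k k) (G : mix R k (k + e)) rad a b :
  (2 <= k)%N -> 0 <= rad -> in_Gkd rad G ->
  (forall a, in_Gkd rad (est1 a)) -> (forall b, in_Gkd rad (est2 b)) ->
  W1 (two_stage est1 est2 a b) G <=
    k%:R * Num.sqrt (resid_const rad) * hellinger (est1 a) G `^ (2^-1) +
    W1const rad * k%:R ^+ 5 *
      hellinger (est2 (map_tuple (qrproj (ma (est1 a))) b)) (qrmix (ma (est1 a)) G) `^ ((2 * k - 1)%:R^-1).
Proof.
move=> k2 r0 GG G1 G2; set V := ma (est1 a); set H2 := est2 _.
set h1 := hellinger (est1 a) G; set h2 := hellinger H2 _.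
have h10 : 0 <= h1 by exact: hellinger_ge0.
apply/ler_addgt0Pr => ep ep0.
have [pi [[pi0 pi1 pi2] pic]] :=
  coupling_le_hellinger k2 (leqnn k) r0 (G2 (map_tuple (qrproj V) b)) (in_Gkd_qrmix V GG) ep0.
apply: (@le_trans _ _ (cost (two_stage est1 est2 a b) G pi)); first by apply: W1_le_cost; split.
pose res j := eucl (tsub (ma G j) (qrlift V (qrproj V (ma G j)))).
have [[w0 w1] _] := GG.
have resb j : mw G j * res j <= Num.sqrt (resid_const rad) * h1 `^ (2^-1).
  rewrite powR12_sqrt// -sqrtrM; last by rewrite mulr_ge0// expR_ge0.
  set u := tsub (ma G j) (qrlift V (qrproj V (ma G j))).
  have ortho b' : dot u (qrlift V b') = 0.
    by rewrite dot_tsubl dot_qrlift dot_qrproj subrr.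
  have := @weighted_residual_le R k (k + e) G (est1 a) rad j u r0 GG (G1 a).
  have -> : dot u (ma G j) = dot u u by rewrite [RHS]dot_tsubr ortho subr0.
  move=> /(_ (fun i => _)) H.
  have {}H : mw G j * dot u u <= resid_const rad * h1.
    by apply: H => // i; rewrite -(qrliftK (ma (est1 a)) i) ortho.
  (* Since the weight w is at most 1, (w |u|)^2 <= w |u|^2, which the residual bound controls. *)
  have mw1 : mw G j <= 1 by rewrite -w1 (bigD1 j)//= lerDl sumr_ge0.
  have m0 : 0 <= mw G j * res j by rewrite mulr_ge0// eucl_ge0.
  rewrite -[leLHS]ger0_norm// -sqrtr_sqr ler_wsqrtr//; apply: le_trans H.
  rewrite exprMn sqr_eucl -/u expr2 -mulrA; apply: ler_piMl => //.
  by rewrite mulr_ge0// dot_ge0.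
have eq1 i j : eucl (tsub (qrlift V (ma H2 i)) (ma G j)) <=
    eucl (tsub (ma H2 i) (qrproj V (ma G j))) + res j.
  apply: (le_trans (eucl_tsub_triangle _ (qrlift V (qrproj V (ma G j))) _)); apply: lerD.
    rewrite !euclE ler_wsqrtr// le_eqVlt; apply/orP; left; apply/eqP.
    by rewrite !(dot_tsubl, dot_tsubr) !dot_qrlift.
  rewrite /res !euclE ler_wsqrtr// le_eqVlt; apply/orP; left; apply/eqP.
  by rewrite !(dot_tsubl, dot_tsubr); ring.
apply: (@le_trans _ _ (cost H2 (qrmix V G) pi + \sum_(j < k) mw G j * res j)).
  have -> : \sum_(j < k) mw G j * res j = \sum_(i < k) \sum_(j < k) pi i j * res j.
    by rewrite exchange_big/=; apply: eq_bigr => j _; rewrite -pi2 mulr_suml.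
  rewrite /cost -big_split/=; apply: ler_sum => i _.
  rewrite -big_split/=; apply: ler_sum => j _; by rewrite -mulrDr ler_wpM2l.
rewrite addrC -addrA; apply: lerD => //.
have -> : k%:R * Num.sqrt (resid_const rad) * h1 `^ (2^-1) =
    \sum_(j < k) Num.sqrt (resid_const rad) * h1 `^ (2^-1).
  by rewrite sumr_const card_ord -mulrA mulr_natl.
by apply: ler_sum => j _; exact: resb.
Qed.

End projected_samples.

(** * Expected loss and assembly of the constants *)

Section risk.
Variable R : realType.
Local Notation pt d := (d.-tuple R).

Definition fst_half T n (xs : (n + n).-tuple T) : n.-tuple T := [tuple tnth xs (lshift n i) | i < n].
Definition snd_half T n (xs : (n + n).-tuple T) : n.-tuple T := [tuple tnth xs (rshift n i) | i < n].

Lemma fst_half_cat T n (a b : n.-tuple T) : fst_half (cat_tuple a b) = a.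
Proof. by apply: eq_from_tnth => i; rewrite tnth_mktuple tnth_lshift. Qed.

Lemma snd_half_cat T n (a b : n.-tuple T) : snd_half (cat_tuple a b) = b.
Proof. by apply: eq_from_tnth => i; rewrite tnth_mktuple tnth_rshift. Qed.

Lemma measurable_fst_half d (T : measurableType d) n :
  measurable_fun setT (@fst_half T n).
Proof.
apply/measurable_fun_tnthP => i.
rewrite (_ : _ \o _ = fun xs => tnth xs (lshift n i)); first exact: measurable_tnth.
by apply/funext => xs /=; rewrite tnth_mktuple.
Qed.

Lemma measurable_snd_half d (T : measurableType d) n :
  measurable_fun setT (@snd_half T n).
Proof.
apply/measurable_fun_tnthP => i.
rewrite (_ : _ \o _ = fun xs => tnth xs (rshift n i)); first exact: measurable_tnth.
by apply/funext => xs /=; rewrite tnth_mktuple.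
Qed.

Lemma measurable_atoms k d n (est : n.-tuple (pt d) -> mix R k d) j :
  measurable_est est -> measurable_fun setT (fun xs => ma (est xs) j).
Proof. by move=> [_ m]; apply/measurable_fun_tnthP => i; exact: m. Qed.

Lemma measurable_two_stage k e n (est1 : n.-tuple (pt (k + e)) -> mix R k (k + e))
    (est2 : n.-tuple (pt k) -> mix R k k) :
  measurable_est est1 -> measurable_est est2 ->
  measurable_est (fun xs => two_stage est1 est2 (fst_half xs) (snd_half xs)).
Proof.
move=> m1 m2; have mV j : measurable_fun setT (fun xs : (n + n).-tuple (pt (k + e)) => ma (est1 (fst_half xs)) j).
  by apply: (measurableT_comp (measurable_atoms j m1)); exact: measurable_fst_half.
have mb : measurable_fun setT (fun xs : (n + n).-tuple (pt (k + e)) =>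
    map_tuple (qrproj (ma (est1 (fst_half xs)))) (snd_half xs)).
  apply/measurable_fun_tnthP => i.
  rewrite (_ : _ \o _ = fun xs => qrproj (ma (est1 (fst_half xs))) (tnth (snd_half xs) i)).
    apply: measurable_qrproj => //.
    exact: (measurableT_comp (measurable_tnth i) (@measurable_snd_half _ (pt (k + e)) n)).
  by apply/funext => xs /=; rewrite tnth_map.
split => [j|j i]; first by case: m2 => m2 _; exact: (measurableT_comp (m2 j) mb).
apply: (measurable_tnth_comp (x := fun xs : (n + n).-tuple (pt (k + e)) =>
  ma (two_stage est1 est2 (fst_half xs) (snd_half xs)) j)).
apply: measurable_qrlift => //.
exact: (measurableT_comp (measurable_atoms j m2) mb).
Qed.

(** For a frozen first half the projected second half is a sample from a mixture in dimension k, to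
    which the uniform guarantee [b2] applies. Jensen's inequality then moves the powers outside each
    expectation. *)
Lemma expect_W1_two_stage k e n (est1 : n.-tuple (pt (k + e)) -> mix R k (k + e))
    (est2 : n.-tuple (pt k) -> mix R k k) (G : mix R k (k + e)) rad b1 b2 :
  (2 <= k)%N -> 0 <= rad -> in_Gkd rad G -> 0 <= b1 -> 0 <= b2 ->
  measurable_est est1 -> measurable_est est2 ->
  (forall a, in_Gkd rad (est1 a)) -> (forall b, in_Gkd rad (est2 b)) ->
  (expect G (fun a => hellinger (est1 a) G) <= b1%:E)%E ->
  (forall G', in_Gkd rad G' -> (expect G' (fun b => hellinger (est2 b) G') <= b2%:E)%E) ->
  (expect G (fun xs => W1 (two_stage est1 est2 (fst_half xs) (snd_half xs)) G) <=
    (k%:R * Num.sqrt (resid_const rad) * b1 `^ (2^-1) +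
     W1const rad * k%:R ^+ 5 * b2 `^ ((2 * k - 1)%:R^-1))%:E)%E.
Proof.
move=> k2 r0 GG b10 b20 m1 m2 G1 G2 E1 E2.
have [Gd _] := GG.
set A1 := k%:R * _; set A2 := W1const rad * _; set q := (2 * k - 1)%:R^-1.
have A10 : 0 <= A1 by rewrite mulr_ge0.
have A20 : 0 <= A2.
  by rewrite mulr_ge0 ?exprn_ge0// !mulr_ge0 ?addr_ge0 ?expR_ge0.
have n1 : (0 < 2 * k - 1)%N by rewrite subn_gt0 (leq_trans k2)// leq_pmull.
have q0 : 0 < q by rewrite invr_gt0 ltr0n.
have q1 : q <= 1 by rewrite invf_le1 ?ltr0n// ler1n.
have i2 : 2^-1 <= 1 :> R by rewrite invf_le1// ler1n.
pose h1 a := hellinger (est1 a) G.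
pose h2 a b := hellinger (est2 (map_tuple (qrproj (ma (est1 a))) b)) (qrmix (ma (est1 a)) G).
have mh1 : measurable_fun setT h1.
  by apply: measurable_hellinger => // a; have [] := G1 a.
have mP (al : R) : measurable_fun setT (fun r : R => r `^ al) by exact: measurable_powR.
have mh1p : measurable_fun setT (fun a => h1 a `^ (2^-1)) by exact: (measurableT_comp (mP _) mh1).
have Pd a : is_mixdist (qrmix (ma (est1 a)) G) by [].
have mhP a : measurable_fun setT (fun y => hellinger (est2 y) (qrmix (ma (est1 a)) G)).
  by apply: measurable_hellinger => // y; have [] := G2 y.
have mmap a : measurable_fun setT (fun b : n.-tuple (pt (k + e)) => map_tuple (qrproj (ma (est1 a))) b).
  apply/measurable_fun_tnthP => i.
  rewrite (_ : _ \o _ = fun xs => qrproj (ma (est1 a)) (tnth xs i)).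
    by apply: (measurable_qrproj (V := fun=> ma (est1 a))) => //; exact: measurable_tnth.
  by apply/funext => xs /=; rewrite tnth_map.
have mh2 a : measurable_fun setT (h2 a) by exact: (measurableT_comp (mhP a) (mmap a)).
have mh2p a : measurable_fun setT (fun b => h2 a b `^ q) by exact: (measurableT_comp (mP _) (mh2 a)).
have tS := tonelli_functional_sexp n Gd.
have S1 := sexp1 n Gd.
have affine (f : n.-tuple (pt (k + e)) -> R) (c s : R) : 0 <= c -> 0 <= s ->
    measurable_fun setT f -> (forall a, 0 <= f a) ->
    sexp G (fun a => (c + s * f a)%:E) = (c%:E + s%:E * sexp G (fun a => (f a)%:E))%E.
  move=> c0 s0 mf f0.
  have mfE : measurable_fun setT (fun a => (f a)%:E) by exact/measurable_EFinP.
  have fE0 a : (0 <= (f a)%:E)%E by rewrite lee_fin.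
  transitivity (sexp G (fun a => c%:E * 1 + s%:E * (f a)%:E)%E).
    by congr sexp; apply/funext => a; rewrite mule1 EFinD EFinM.
  rewrite (tf_add tS); last 4 first.
  - by apply: emeasurable_funM; exact: measurable_cst.
  - by apply: emeasurable_funM => //; exact: measurable_cst.
  - by move=> a; rewrite mule_ge0// lee_fin.
  - by move=> a; rewrite mule_ge0// lee_fin.
  by rewrite (tf_scale tS)// (tf_scale tS)// S1 mule1.
have R1 : (sexp G (fun a => (h1 a `^ (2^-1))%:E) <= (b1 `^ (2^-1))%:E)%E.
  apply: tf_powR_le => //; first by move=> a; exact: hellinger_ge0.
  by rewrite -expectE.
have R2 a : (sexp G (fun b => (h2 a b `^ q)%:E) <= (b2 `^ q)%:E)%E.
  have := sexp_qrproj (ma (est1 a)) Gd (F := fun y => (hellinger (est2 y) (qrmix (ma (est1 a)) G) `^ q)%:E).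
  rewrite /h2 => ->; last 2 first.
  - by apply/measurable_EFinP; exact: (measurableT_comp (mP _) (mhP a)).
  - by move=> x; rewrite lee_fin powR_ge0.
  apply: tf_powR_le => //.
  - exact: tonelli_functional_sexp.
  - exact: sexp1.
  - by move=> x; exact: hellinger_ge0.
  - by rewrite -expectE; apply: E2; exact: in_Gkd_qrmix.
apply: (@le_trans _ _ (sexp G (fun a => (A2 * b2 `^ q + A1 * h1 a `^ (2^-1))%:E))).
  apply: (expect_cat_le (U := fun a b => A1 * h1 a `^ (2^-1) + A2 * h2 a b `^ q)) => //.
  - by move=> xs; exact: W1_ge0.
  - by move=> a b; rewrite fst_half_cat snd_half_cat; exact: W1_two_stage_le.
  - move=> a; apply: measurable_funD => //; exact: measurable_funM.
  - move=> a; rewrite affine//.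
    + rewrite [leRHS]EFinD [leLHS]addeC; apply: leeD => //.
      by rewrite (EFinM A2); apply: lee_wpmul2l; rewrite ?lee_fin//; exact: R2.
    + by rewrite mulr_ge0// powR_ge0.
    + by move=> b; exact: powR_ge0.
rewrite affine//; last by move=> a; exact: powR_ge0.
  rewrite [leRHS]EFinD [leLHS]addeC; apply: leeD => //.
  by rewrite (EFinM A1); apply: lee_wpmul2l; rewrite ?lee_fin//; exact: R1.
by rewrite mulr_ge0// powR_ge0.
Qed.

(** In dimension at most k the moment argument applies without projection, so the density estimate
    from the first half serves as it is. *)
Lemma expect_W1_one_stage k d n (est : n.-tuple (pt d) -> mix R k d) (G : mix R k d) rad b :
  (2 <= k)%N -> (d <= k)%N -> 0 <= rad -> in_Gkd rad G -> 0 <= b ->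
  measurable_est est -> (forall a, in_Gkd rad (est a)) ->
  (expect G (fun a => hellinger (est a) G) <= b%:E)%E ->
  (expect G (fun xs => W1 (est (@fst_half (pt d) n xs)) G) <=
    (W1const rad * k%:R ^+ 5 * b `^ ((2 * k - 1)%:R^-1))%:E)%E.
Proof.
move=> k2 dk r0 GG b0 me G1 E1; have [Gd _] := GG.
set A2 := W1const rad * _; set q := (2 * k - 1)%:R^-1.
have A20 : 0 <= A2.
  by rewrite mulr_ge0 ?exprn_ge0// !mulr_ge0 ?addr_ge0 ?expR_ge0.
have n1 : (0 < 2 * k - 1)%N by rewrite subn_gt0 (leq_trans k2)// leq_pmull.
have q0 : 0 < q by rewrite invr_gt0 ltr0n.
have q1 : q <= 1 by rewrite invf_le1 ?ltr0n// ler1n.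
pose h1 a := hellinger (est a) G.
have mh1 : measurable_fun setT h1.
  by apply: measurable_hellinger => // a; have [] := G1 a.
have mh1p : measurable_fun setT (fun a => (h1 a `^ q)%:E).
  by apply/measurable_EFinP; exact: (measurableT_comp (measurable_powR _) mh1).
have tS := tonelli_functional_sexp n Gd.
have S1 := sexp1 n Gd.
have R1 : (sexp G (fun a => (h1 a `^ q)%:E) <= (b `^ q)%:E)%E.
  apply: tf_powR_le => //; first by move=> a; exact: hellinger_ge0.
  by rewrite -expectE.
apply: (@le_trans _ _ (sexp G (fun a => (A2 * h1 a `^ q)%:E))).
  apply: (expect_cat_le (U := fun a b => A2 * h1 a `^ q)) => //.
  - by move=> xs; exact: W1_ge0.
  - move=> a b'; rewrite fst_half_cat; apply/ler_addgt0Pr => ep ep0.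
    have [pi [pic cle]] := coupling_le_hellinger k2 dk r0 (G1 a) GG ep0.
    exact: le_trans (W1_le_cost pic) cle.
  - move=> a; have := tf_scale tS (c := A2 * h1 a `^ q) (f := fun=> 1%E).
    rewrite S1 !mule1 => -> //; last by rewrite mulr_ge0// powR_ge0.
have h1p0 a : (0 <= (h1 a `^ q)%:E)%E by rewrite lee_fin powR_ge0.
apply: (@le_trans _ _ (sexp G (fun a => A2%:E * (h1 a `^ q)%:E)%E)).
  by apply: (tf_le tS) => a; rewrite ?(EFinM A2)// lee_fin mulr_ge0// powR_ge0.
rewrite (tf_scale tS A20 mh1p h1p0) (EFinM A2).
by apply: lee_wpmul2l; [rewrite lee_fin|exact: R1].
Qed.

(** With m = 4k - 2, k <= m <= 2^m; take m-th roots. This turns the rate (k/n)^(1/m) of the second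
    stage into a multiple of (1/n)^(1/m). *)
Lemma sqrt_k_powR_le k : (2 <= k)%N -> k%:R `^ ((4 * k - 2)%:R^-1) <= 2 :> R.
Proof.
move=> k2; set m := (4 * k - 2)%N.
have km : (k <= m)%N.
  by rewrite /m leq_subRL; [rewrite (leq_trans (leq_add k2 (leqnn k)))// addnn -mul2n leq_mul2r orbT
    |rewrite (leq_trans k2)// leq_pmull].
have m0 : (0 < m)%N by rewrite (leq_trans _ km)// (leq_trans _ k2).
have km2 : k%:R <= (2 ^ m)%:R :> R by rewrite ler_nat (leq_trans km)// ltnW// ltn_expl.
apply: (@le_trans _ _ ((2 ^ m)%:R `^ (m%:R^-1))).
  by apply: ge0_ler_powR; rewrite ?nnegrE ?invr_ge0.
by rewrite natrX -powR_mulrn// -powRrM mulfV ?powRr1// pnatr_eq0 -lt0n.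
Qed.

(** 1 + 4 exp(1 + rad) dominates the square root of [resid_const], the 1 also makes C k >= 1, and
    the 2 absorbs [sqrt_k_powR_le]. *)
Definition main_const (rad : R) := 1 + 4 * expR (1 + rad) + 2 * W1const rad.

Lemma first_term_le rad k ck r : (2 <= k)%N -> 0 <= ck -> 0 <= r ->
  k%:R * Num.sqrt (resid_const rad) * (ck * Num.sqrt r) `^ (2^-1) <=
  (main_const rad * k%:R) `^ (k%:R / 2) * Num.sqrt ck * r `^ (4^-1).
Proof.
move=> k2 ck0 r0.
have -> : (ck * Num.sqrt r) `^ (2^-1) = Num.sqrt ck * r `^ (4^-1).
  rewrite (powRM _ ck0 (sqrtr_ge0 r)) powR12_sqrt//; congr (_ * _).
  by rewrite -[Num.sqrt r]powR12_sqrt// -powRrM; congr (_ `^ _); field.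
rewrite mulrA ler_wpM2r ?powR_ge0// ler_wpM2r ?sqrtr_ge0//.
have k0 : 0 <= k%:R :> R by [].
have W0 : 0 <= W1const rad by rewrite !mulr_ge0 ?addr_ge0 ?expR_ge0.
have e0 : 0 <= expR (1 + rad) by exact: expR_ge0.
have C1 : 1 <= main_const rad by rewrite /main_const; lra.
have k1 : 1 <= k%:R :> R by rewrite ler1n (leq_trans _ k2).
have Ck1 : 1 <= main_const rad * k%:R by nra.
apply: (@le_trans _ _ (main_const rad * k%:R)).
  rewrite mulrC ler_wpM2r//.
  apply: (@le_trans _ _ (1 + 4 * expR (1 + rad))); last by rewrite /main_const; lra.
  rewrite -[leRHS]ger0_norm; last by lra.
  rewrite -sqrtr_sqr ler_wsqrtr// /resid_const.
  have := sqr_ge0 (4 * expR (1 + rad) - 1); nra.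
(* C k >= 1 and k/2 >= 1, so the power k/2 only enlarges the bound. *)
rewrite -[leLHS]powRr1; last by lra.
apply: ler_powR => //.
by rewrite ler_pdivlMr// mul1r ler_nat.
Qed.

Lemma second_term_le rad k ck n : (2 <= k)%N -> (0 < n)%N -> 0 <= ck ->
  W1const rad * k%:R ^+ 5 * (ck * Num.sqrt (k%:R / n%:R)) `^ ((2 * k - 1)%:R^-1) <=
  main_const rad * k%:R ^+ 5 * ck `^ ((2 * k - 1)%:R^-1) * (n%:R^-1) `^ ((4 * k - 2)%:R^-1).
Proof.
move=> k2 n0 ck0; set q := (2 * k - 1)%:R^-1; set q2 := (4 * k - 2)%:R^-1.
have qE : 2^-1 * q = q2.
  rewrite /q /q2 -invfM -natrM mulnBr mulnA //.
have W0 : 0 <= W1const rad by rewrite !mulr_ge0 ?addr_ge0 ?expR_ge0.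
have e0 : 0 <= expR (1 + rad) by exact: expR_ge0.
rewrite powRM// ?sqrtr_ge0// -[Num.sqrt _]powR12_sqrt ?divr_ge0// -powRrM qE.
rewrite powRM ?invr_ge0//.
have K := sqrt_k_powR_le k2; rewrite -/q2 in K.
set a := ck `^ q; set c := _^-1 `^ q2; set x := k%:R `^ q2 in K *.
have a0 : 0 <= a by exact: powR_ge0.
have c0 : 0 <= c by exact: powR_ge0.
have x0 : 0 <= x by exact: powR_ge0.
have y0 : 0 <= k%:R ^+ 5 :> R by exact: exprn_ge0.
move: (k%:R ^+ 5) y0 => y y0.
have -> : W1const rad * y * (a * (x * c)) = (W1const rad * x) * (y * a * c) by ring.
have -> : main_const rad * y * a * c = main_const rad * (y * a * c) by ring.
apply: ler_wpM2r; first by rewrite mulr_ge0// mulr_ge0.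
by rewrite /main_const; nra.
Qed.

Lemma in_Gkd_zero rad k d : 0 <= rad -> (0 < k)%N ->
  exists G : mix R k d, in_Gkd rad G.
Proof.
move=> r0 k0; exists (Mix (fun j => (j == Ordinal k0)%:R) (fun=> zerov R d)); split; [split|].
- by move=> j /=.
- by rewrite /= (bigD1 (Ordinal k0))//= ?eqxx big1 ?addr0// => j /negbTE ->.
- by move=> j; rewrite /= euclE dot0l sqrtr0.
Qed.

(** The class contains a point mass at the origin, and its nonnegative risk lies below [ck] times a
    positive number. *)
Lemma risk_const_ge0 k d n (est : n.-tuple (pt d) -> mix R k d) rad ck : 0 <= rad ->
  (0 < k)%N -> (0 < d)%N -> (0 < n)%N ->
  (forall G : mix R k d, in_Gkd rad G ->
    (expect G (fun xs => hellinger (est xs) G) <= (ck * Num.sqrt (d%:R / n%:R))%:E)%E) ->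
  0 <= ck.
Proof.
move=> r0 k0 d0 n0 H; have [G GG] := in_Gkd_zero d r0 k0.
have s0 : 0 < Num.sqrt (d%:R / n%:R) :> R by rewrite sqrtr_gt0 divr_gt0 ?ltr0n.
rewrite -(pmulr_lge0 _ s0) -lee_fin; apply: le_trans (H G GG).
rewrite expectE; have [Gd _] := GG.
apply: (tf_ge0 (tonelli_functional_sexp n Gd)) => xs; rewrite lee_fin; exact: hellinger_ge0.
Qed.

End risk.

Theorem mainTheorem10 (R : realType) (rad : R) :
  0 < rad ->
  exists C : R, 0 < C /\
  forall (k : nat) (ck : R) (n : nat), (2 <= k)%N -> (0 < n)%N ->
  (forall d : nat, (0 < d)%N ->
     exists est : n.-tuple (d.-tuple R) -> mix R k d,
       [/\ measurable_est est,
           (forall xs, in_Gkd rad (est xs)) &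
           forall G : mix R k d, in_Gkd rad G ->
             (expect G (fun xs => hellinger (est xs) G)
                <= (ck * Num.sqrt (d%:R / n%:R))%:E)%E]) ->
  forall d : nat, (0 < d)%N ->
     exists est : (2 * n).-tuple (d.-tuple R) -> mix R k d,
       [/\ measurable_est est,
           (forall xs, is_mixdist (est xs)) &
           forall G : mix R k d, in_Gkd rad G ->
             (expect G (fun xs => W1 (est xs) G)
                <= ((C * k%:R) `^ (k%:R / 2) * Num.sqrt ck * (d%:R / n%:R) `^ (4^-1)
                    + C * k%:R ^+ 5 * ck `^ ((2 * k - 1)%:R^-1)
                      * (n%:R^-1) `^ ((4 * k - 2)%:R^-1))%:E)%E].
Proof.
move=> rad0; have r0 := ltW rad0.
exists (main_const rad); split.
  by rewrite /main_const !ltr_pwDl ?ltr01// !mulr_ge0 ?addr_ge0 ?expR_ge0.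
move=> k ck n k2 n0 H d d0; have k0 : (0 < k)%N by exact: leq_trans k2.
rewrite (_ : (2 * n)%N = (n + n)%N); last by rewrite mul2n addnn.
have [estk [mk Gk Ek]] := H k k0.
have ck0 := risk_const_ge0 r0 k0 k0 n0 Ek.
(* The projection is defined on dimensions of the form [k + e]; smaller dimensions use the one-stage
   estimator. *)
have [dk|kd] := leqP d k.
  have [estd [md Gd Ed]] := H d d0.
  exists (fun xs => estd (fst_half xs)); split.
  - split => [j|j i]; case: md => [m1 m2].
      by apply: (measurableT_comp (m1 j)); exact: measurable_fst_half.
    by apply: (measurableT_comp (m2 j i)); exact: measurable_fst_half.
  - by move=> xs; have [] := Gd (fst_half xs).
  - move=> G GG.
    have b0 : 0 <= ck * Num.sqrt (k%:R / n%:R) by rewrite mulr_ge0// sqrtr_ge0.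
    (* Weakening d to k makes the one-stage risk match the second term of the bound; the first term
       is then only a nonnegative surplus. *)
    have Ed' : (expect G (fun a => hellinger (estd a) G) <= (ck * Num.sqrt (k%:R / n%:R))%:E)%E.
      apply: (le_trans (Ed G GG)); rewrite lee_fin ler_wpM2l// ler_wsqrtr//.
      by rewrite ler_wpM2r ?invr_ge0// ler_nat.
    apply: (le_trans (expect_W1_one_stage k2 dk r0 GG b0 md Gd Ed')).
    rewrite lee_fin; apply: (le_trans (second_term_le rad k2 n0 ck0)).
    by rewrite lerDr mulr_ge0 ?powR_ge0// mulr_ge0 ?powR_ge0 ?sqrtr_ge0.
have [e de] : exists e, d = (k + e)%N by exists (d - k)%N; rewrite subnKC// ltnW.
subst d; have [estd [md Gd Ed]] := H _ d0.
exists (fun xs => two_stage estd estk (fst_half xs) (snd_half xs)); split.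
- exact: measurable_two_stage.
- by move=> xs; have [[]] := Gk (map_tuple (qrproj (ma (estd (fst_half xs)))) (snd_half xs)).
- move=> G GG.
  apply: (le_trans (expect_W1_two_stage k2 r0 GG _ _ md mk Gd Gk (Ed G GG) Ek)).
  + by rewrite mulr_ge0// sqrtr_ge0.
  + by rewrite mulr_ge0// sqrtr_ge0.
  rewrite lee_fin; apply: lerD; last exact: second_term_le.
  by apply: first_term_le => //; rewrite divr_ge0.
Qed.
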